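(* Let $\Sigma^k\subset(M^n,g)$ be a submanifold of a Riemannian manifold, $n\ge3$, $1\le k\le n-1$, with induced metric $h$ (and $n\ne4$ in the statements about $P_4$, $T$ and $Q_4$). The extrinsic operators $P_2$, $P_4$ (recalled in the context) can be written $$P_2=\overline P_2+\frac{k-2}{2}\mathsf G\quad(k>1),\qquad P_4=\overline P_4+\nabla^\alpha(\widetilde T_{\alpha\beta}\nabla^\beta)+\frac{k-4}{2}\widetilde Q_4\quad(k>2),$$ where $$\widetilde T_{\alpha\beta}=4\mathsf F_{\alpha\beta}-(k-2)\mathsf G\,h_{\alpha\beta},$$ $$\widetilde Q_4=-\Delta\mathsf G-2|\mathsf F|^2+\frac k2\mathsf G^2-4\mathsf F_{\alpha\beta}\overline{\mathsf P}^{\alpha\beta}+k\,\mathsf G\,\overline{\mathsf J}+2|\mathsf D|^2-2H^{\alpha'}H^{\beta'}W^\alpha{}_{\alpha'\alpha\beta'}-4H^{\alpha'}C^\alpha{}_{\alpha\alpha'}-\frac{2}{n-4}B_\alpha{}^\alpha.$$ In particular, $Q_2=\overline{\mathsf J}+\mathsf G$ (for $k>1$), and $T_{\alpha\beta}=\overline T_{\alpha\beta}+\widetilde T_{\alpha\beta}$, $Q_4=\overline Q_4+\widetilde Q_4$ (for $k>2$).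
   Context: **Curvature conventions for $(M^n,g)$.** Indices $i,j,k,l$ refer to $TM$. $R_{ij}=R^k{}_{ikj}$, $R=R^i{}_i$, with sign such that spheres have positive scalar curvature. Schouten: $\mathsf P_{ij}=\frac1{n-2}\big(R_{ij}-\frac{R}{2(n-1)}g_{ij}\big)$. Weyl: $R_{ijkl}=W_{ijkl}+\mathsf P_{ik}g_{jl}-\mathsf P_{jk}g_{il}-\mathsf P_{il}g_{jk}+\mathsf P_{jl}g_{ik}$. Cotton: $C_{ijk}={}^g\nabla_k\mathsf P_{ij}-{}^g\nabla_j\mathsf P_{ik}$. Bach: $B_{ij}={}^g\nabla^kC_{ijk}-\mathsf P^{kl}W_{kijl}$. **Submanifold conventions.** Indices $\alpha,\beta,\gamma$ refer to $T\Sigma$, and $\alpha',\beta'$ to the normal bundle $N\Sigma$; tensors on $M$ restricted to $\Sigma$ split into tangential, mixed and normal components. Repeated tangential indices are traced over $T\Sigma$ with $h$. $L(X,Y)=({}^g\nabla_XY)^\perp$ is the second fundamental form, $H^{\alpha'}=\frac1kL_\alpha{}^{\alpha\alpha'}$ the mean curvature vector, $\mathring L_{\alpha\beta\alpha'}=L_{\alpha\beta\alpha'}-H_{\alpha'}h_{\alpha\beta}$ the trace-free part. $\nabla$ is the induced connection on $T\Sigma$, $N\Sigma$ and tensor products; $\Delta=\nabla^\alpha\nabla_\alpha$ (sign $\Delta=\sum\partial_i^2$ on Euclidean space). $\nabla^\alpha(T_{\alpha\beta}\nabla^\beta)$ denotes $f\mapsto\nabla^\alpha(T_{\alpha\beta}\nabla^\beta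 f)$. **Extrinsic operators.** The minimal submanifold extrinsic GJMS operators of orders 2 and 4 and their $Q$-curvatures are given by $P_2=-\Delta+\frac{k-2}2Q_2$, $P_4=\Delta^2+\nabla^\alpha(T_{\alpha\beta}\nabla^\beta)+\frac{k-4}2Q_4$ ($n\ne4$ for $P_4$), with $$Q_2=\mathsf P_\alpha{}^\alpha+\tfrac k2|H|^2,\qquad T_{\alpha\beta}=4\mathsf P_{\alpha\beta}+4H^{\alpha'}L_{\alpha\beta\alpha'}-\big[(k-2)\mathsf P_\gamma{}^\gamma+\tfrac12(k^2-2k+4)|H|^2\big]h_{\alpha\beta},$$ $$\begin{aligned}Q_4&=-\Delta\big(\mathsf P_\alpha{}^\alpha+\tfrac k2|H|^2\big)-2\big|\mathsf P_{\alpha\beta}+H^{\alpha'}L_{\alpha\beta\alpha'}-\tfrac12|H|^2h_{\alpha\beta}\big|^2+2\big|\mathsf P_{\alpha\alpha'}-\nabla_\alpha H_{\alpha'}\big|^2+\tfrac k2\big(\mathsf P_\alpha{}^\alpha+\tfrac k2|H|^2\big)^2\\&\quad-2W^\alpha{}_{\alpha'\alpha\beta'}H^{\alpha'}H^{\beta'}-4C^\alpha{}_{\alpha\alpha'}H^{\alpha'}-\tfrac{2}{n-4}B^\alpha{}_\alpha.\end{aligned}$$ For the present statement these formulas may be taken as the definition of $P_2,P_4,Q_2,T,Q_4$. **Intrinsic quantities** (overlined) are those of the metric $h$ on $\Sigma$: $\overline{\mathsf P}_{\alpha\beta}$ is its Schouten tensor ($k\ge3$), $\overline R$ its scalar curvature,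 $\overline{\mathsf J}=\frac{\overline R}{2(k-1)}$ ($k\ge2$). The intrinsic Yamabe and Paneitz operators are $\overline P_2=-\Delta+\frac{k-2}2\overline{\mathsf J}$ and $\overline P_4=\Delta^2+\nabla^\alpha(\overline T_{\alpha\beta}\nabla^\beta)+\frac{k-4}2\overline Q_4$, where $\overline T_{\alpha\beta}=4\overline{\mathsf P}_{\alpha\beta}-(k-2)\overline{\mathsf J}h_{\alpha\beta}$ and $\overline Q_4=-\Delta\overline{\mathsf J}-2|\overline{\mathsf P}|^2+\frac k2\overline{\mathsf J}^2$. **Extrinsic tensors.** $\mathsf G=\frac1{2(k-1)}\big(|\mathring L|^2-W_{\alpha\beta}{}^{\alpha\beta}\big)$ ($k\ge2$); Fialkow tensor $\mathsf F_{\alpha\beta}=\frac1{k-2}\big(\mathring L_{\alpha\gamma\alpha'}\mathring L_\beta{}^{\gamma\alpha'}-W_{\alpha\gamma\beta}{}^\gamma-\mathsf Gh_{\alpha\beta}\big)$ ($k\ge3$); $\mathsf D_{\alpha\alpha'}=\frac1{1-k}\big(\nabla^\beta\mathring L_{\alpha\beta\alpha'}+W_{\alpha\beta\alpha'}{}^\beta\big)$ ($k\ge2$). *)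

(* Defs.v *)
From HB Require Import structures.
From mathcomp Require Import all_boot all_order all_algebra.
From mathcomp Require Import all_classical all_reals all_analysis.

Set Implicit Arguments.
Unset Strict Implicit.
Unset Printing Implicit Defensive.

Import Order.TTheory GRing.Theory Num.Theory.
Import numFieldNormedType.Exports.

Local Open Scope classical_set_scope.
Local Open Scope ring_scope.

(* MathComp-Analysis has no manifolds.  A manifold is a topological space with
   a smooth atlas, a metric is the family of its component matrices in the
   charts, and every tensor is given by its components in a chart, as a
   function of the coordinates.  Indices i j k l m (ambient coordinates) and
   al be ga de (coordinates on the submanifold) range over ordinals; the order
   of the arguments of a tensor is the order of its indices.  Components live
   on the open set of coordinates covered by the chart and are junk outside:
   derivatives only see germs, so this is harmless. *)

Section Calculus.
Context {R : realType} {n : nat}.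

Definition pd (i : 'I_n) (f : 'rV[R]_n -> R) : 'rV[R]_n -> R :=
  fun x => 'D_(delta_mx 0 i) f x.

(* C^infinity on an open set: every iterated partial derivative is
   (Frechet-)differentiable at every point of the set. *)
Definition smooth (U : set 'rV[R]_n) (f : 'rV[R]_n -> R) : Prop :=
  forall (s : seq 'I_n) (x : 'rV[R]_n), U x -> differentiable (foldr pd f s) x.

Definition smooth_map (m : nat) (U : set 'rV[R]_n)
    (F : 'rV[R]_n -> 'rV[R]_m) : Prop :=
  forall i : 'I_m, smooth U (fun x => F x 0 i).

(* Rows of 'J F u are the vectors dF(d_al), so this is the matrix
   g_ij(F u) d_al F^i d_be F^j of the metric F^* g. *)
Definition pullback (m : nat) (g : 'rV[R]_m -> 'M[R]_m)
    (F : 'rV[R]_n -> 'rV[R]_m) : 'rV[R]_n -> 'M[R]_n :=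
  fun u => 'J F u *m g (F u) *m ('J F u)^T.

End Calculus.

(* A homeomorphism, with its inverse, from an open subset of R^m onto a
   relatively open subset of S.  For S = setT it is (the inverse of) a chart. *)
Record coord_patch (R : realType) (T : topologicalType) (S : set T) (m : nat) :=
  CoordPatch {
    pdom : set 'rV[R]_m;
    prange : set T;
    pmap :> 'rV[R]_m -> T;
    pinv : T -> 'rV[R]_m;
    pdom_open : open pdom;
    prange_open : exists2 O : set T, open O & prange = S `&` O;
    pmap_range : forall u, pdom u -> prange (pmap u);
    pinv_dom : forall p, prange p -> pdom (pinv p);
    pmapK : forall u, pdom u -> pinv (pmap u) = u;
    pinvK : forall p, prange p -> pmap (pinv p) = p;
    pmap_continuous : {within pdom, continuous pmap};
    pinv_continuous : {within prange, continuous pinv} }.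

Section Patches.
Context {R : realType} {T : topologicalType} {n m : nat} {S : set T}.

(* The map b read in the chart a, and the open set on which it is defined. *)
Definition in_chart (a : coord_patch R [set: T] n) (b : coord_patch R S m) :
  'rV[R]_m -> 'rV[R]_n := fun u => pinv a (b u).

Definition overlap (a : coord_patch R [set: T] n) (b : coord_patch R S m) :
  set 'rV[R]_m := pdom b `&` [set u | prange a (b u)].

End Patches.

Record smooth_manifold (R : realType) (n : nat) := SmoothManifold {
  carrier :> topologicalType;
  manifold_hausdorff : hausdorff_space carrier;
  manifold_second_countable : @second_countable carrier;
  atlas : set (coord_patch R [set: carrier] n);
  atlas_cover : forall p : carrier, exists2 a, atlas a & prange a p;
  atlas_smooth : forall a b, atlas a -> atlas b ->
    smooth_map (overlap b a) (in_chart b a) }.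

Record riemannian_metric (R : realType) (n : nat) (M : smooth_manifold R n) :=
  RiemannianMetric {
    metric :> coord_patch R [set: M] n -> 'rV[R]_n -> 'M[R]_n;
    metric_smooth : forall a, atlas a ->
      forall i j, smooth (pdom a) (fun x => metric a x i j);
    metric_sym : forall a, atlas a ->
      forall x, pdom a x -> (metric a x)^T = metric a x;
    metric_pos : forall a, atlas a -> forall x, pdom a x ->
      forall v : 'rV[R]_n, v != 0 -> 0 < (v *m metric a x *m v^T) 0 0;
    metric_change : forall a b, atlas a -> atlas b ->
      forall x, overlap b a x ->
      metric a x = pullback (metric b) (in_chart b a) x }.

Section Submanifolds.
Context {R : realType} {n : nat} (M : smooth_manifold R n).

(* Regular local parametrizations: smooth immersions in the charts of M. *)
Definition parametrization (S : set M) (k : nat)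
    (b : coord_patch R S k) : Prop :=
  forall a, atlas a -> smooth_map (overlap a b) (in_chart a b) /\
    forall u, overlap a b u -> row_free ('J (in_chart a b) u).

Definition submanifold (S : set M) (k : nat) : Prop :=
  forall p, S p ->
    exists2 b : coord_patch R S k, parametrization b & prange b p.

(* Only the values of f on S matter. *)
Definition smooth_on (S : set M) (k : nat) (f : M -> R) : Prop :=
  forall b : coord_patch R S k, parametrization b -> smooth (pdom b) (f \o b).

End Submanifolds.

Section Intrinsic.
Context {R : realType} {n : nat} (g : 'rV[R]_n -> 'M[R]_n).
Local Notation scalar := ('rV[R]_n -> R).
Local Notation tensor1 := ('I_n -> scalar).
Local Notation tensor2 := ('I_n -> tensor1).
Local Notation tensor3 := ('I_n -> tensor2).

Definition ginv (i j : 'I_n) : scalar := fun x => invmx (g x) i j.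

(* Gamma^i_jk *)
Definition christoffel (i j k : 'I_n) : scalar := fun x =>
  2^-1 * \sum_m ginv i m x *
    (pd j (fun y => g y m k) x + pd k (fun y => g y m j) x
     - pd m (fun y => g y j k) x).

(* nabla1 w j i is nabla_j w_i: the index of differentiation comes first. *)
Definition nabla1 (w : tensor1) (j i : 'I_n) : scalar := fun x =>
  pd j (w i) x - \sum_m christoffel m j i x * w m x.

Definition nabla2 (S : tensor2) (k i j : 'I_n) : scalar := fun x =>
  pd k (S i j) x - \sum_m christoffel m k i x * S m j x
  - \sum_m christoffel m k j x * S i m x.

Definition nabla3 (S : tensor3) (l i j k : 'I_n) : scalar := fun x =>
  pd l (S i j k) x - \sum_m christoffel m l i x * S m j k x
  - \sum_m christoffel m l j x * S i m k x
  - \sum_m christoffel m l k x * S i j m x.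

(* R^i_jkl, i.e. R(d_k, d_l) d_j = R^i_jkl d_i; with R_jl = R^i_jil spheres
   have positive scalar curvature. *)
Definition riemann_up (i j k l : 'I_n) : scalar := fun x =>
  pd k (christoffel i l j) x - pd l (christoffel i k j) x
  + \sum_m (christoffel i k m x * christoffel m l j x
            - christoffel i l m x * christoffel m k j x).

Definition riemann (i j k l : 'I_n) : scalar := fun x =>
  \sum_m g x i m * riemann_up m j k l x.

Definition ricci (i j : 'I_n) : scalar := fun x =>
  \sum_k riemann_up k i k j x.

Definition trace (S : tensor2) : scalar := fun x =>
  \sum_i \sum_j ginv i j x * S i j x.

Definition inner2 (S T : tensor2) : scalar := fun x =>
  \sum_i \sum_j \sum_k \sum_l
    ginv i k x * ginv j l x * S i j x * T k l x.

Definition scal : scalar := trace ricci.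

Definition schouten (i j : 'I_n) : scalar := fun x =>
  (n%:R - 2)^-1 * (ricci i j x - scal x / (2 * (n%:R - 1)) * g x i j).

Definition schoutenJ : scalar := fun x => scal x / (2 * (n%:R - 1)).

Definition weyl (i j k l : 'I_n) : scalar := fun x =>
  riemann i j k l x
  - (schouten i k x * g x j l - schouten j k x * g x i l
     - schouten i l x * g x j k + schouten j l x * g x i k).

Definition cotton (i j k : 'I_n) : scalar := fun x =>
  nabla2 schouten k i j x - nabla2 schouten j i k x.

Definition bach (i j : 'I_n) : scalar := fun x =>
  \sum_k \sum_l ginv k l x * nabla3 cotton l i j k x
  - inner2 schouten (fun k l => weyl k i j l) x.

Definition laplacian (f : scalar) : scalar :=
  trace (fun i j => nabla1 (fun m => pd m f) i j).

(* nabla^i (T_ij nabla^j f) *)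
Definition div_grad (T : tensor2) (f : scalar) : scalar :=
  trace (fun i j => nabla1
    (fun m x => \sum_p \sum_q T m p x * ginv p q x * pd q f x) i j).

Definition yamabe_op (f : scalar) : scalar := fun x =>
  - laplacian f x + (n%:R - 2) / 2 * schoutenJ x * f x.

Definition paneitz_T (i j : 'I_n) : scalar := fun x =>
  4 * schouten i j x - (n%:R - 2) * schoutenJ x * g x i j.

Definition paneitz_Q : scalar := fun x =>
  - laplacian schoutenJ x - 2 * inner2 schouten schouten x
  + n%:R / 2 * schoutenJ x ^+ 2.

Definition paneitz_op (f : scalar) : scalar := fun x =>
  laplacian (laplacian f) x + div_grad paneitz_T f x
  + (n%:R - 4) / 2 * paneitz_Q x * f x.

End Intrinsic.

(* F is a local parametrization of the submanifold, read in a chart in which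
   the metric is g.  Normal vectors are represented by their ambient
   components; a normal index al' of a covariant tensor is represented by an
   ambient index j into which the normal part of d_j has been inserted. *)
Section Extrinsic.
Context {R : realType} {n k : nat}.
Context (g : 'rV[R]_n -> 'M[R]_n) (F : 'rV[R]_k -> 'rV[R]_n).
Local Notation scalar := ('rV[R]_k -> R).
Local Notation field := ('I_n -> scalar).
Local Notation h := (pullback g F).
Local Notation kk := (k%:R : R).

Definition tangent (al : 'I_k) : field := fun i u => 'J F u al i.

Definition eval2 (S : 'I_n -> 'I_n -> 'rV[R]_n -> R) (X Y : field) : scalar :=
  fun u => \sum_i \sum_j S i j (F u) * X i u * Y j u.

Definition eval3 (S : 'I_n -> 'I_n -> 'I_n -> 'rV[R]_n -> R)
    (X Y Z : field) : scalar :=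
  fun u => \sum_i \sum_j \sum_l S i j l (F u) * X i u * Y j u * Z l u.

Definition eval4 (S : 'I_n -> 'I_n -> 'I_n -> 'I_n -> 'rV[R]_n -> R)
    (X Y Z V : field) : scalar :=
  fun u => \sum_i \sum_j \sum_l \sum_m
    S i j l m (F u) * X i u * Y j u * Z l u * V m u.

Definition inner (X Y : field) : scalar := eval2 (fun i j x => g x i j) X Y.

Definition normal_part (X : field) : field := fun i u =>
  X i u - \sum_al \sum_be
    ginv h al be u * inner X (tangent be) u * tangent al i u.

(* normal part of the coordinate vector d_j *)
Definition normal_coord (j : 'I_n) : field :=
  normal_part (fun i _ => (i == j)%:R).

Definition lower (X : field) (j : 'I_n) : scalar := fun u =>
  \sum_i g (F u) j i * X i u.

(* Levi-Civita derivative, along d_al, of a vector field along F *)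
Definition nabla_along (al : 'I_k) (X : field) : field := fun i u =>
  pd al (X i) u
  + \sum_j \sum_l christoffel g i j l (F u) * tangent al j u * X l u.

Definition nabla_normal (al : 'I_k) (N : field) : field :=
  normal_part (nabla_along al N).

Definition sff (al be : 'I_k) : field :=
  normal_part (nabla_along al (tangent be)).

Definition meanH : field := fun i u =>
  kk^-1 * \sum_al \sum_be ginv h al be u * sff al be i u.

Definition sff0 (al be : 'I_k) : field := fun i u =>
  sff al be i u - meanH i u * h u al be.

Definition normH2 : scalar := inner meanH meanH.

(* nabla_ga of the trace-free second fundamental form, for the induced
   connection on T*S (x) T*S (x) NS *)
Definition nabla_sff0 (ga al be : 'I_k) : field := fun i u =>
  nabla_normal ga (sff0 al be) i u
  - \sum_de christoffel h de ga al u * sff0 de be i u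
  - \sum_de christoffel h de ga be u * sff0 al de i u.

(* P_{al be} and P_{al al'} *)
Definition schoutenTT (al be : 'I_k) : scalar :=
  eval2 (schouten g) (tangent al) (tangent be).

Definition schoutenTN (al : 'I_k) (j : 'I_n) : scalar :=
  eval2 (schouten g) (tangent al) (normal_coord j).

Definition trP : scalar := trace h schoutenTT.

(* |w|^2 for w_{al al'} *)
Definition normTN2 (w : 'I_k -> 'I_n -> scalar) : scalar := fun u =>
  \sum_al \sum_be \sum_i \sum_j
    ginv h al be u * ginv g i j (F u) * w al i u * w be j u.

(* W^al_{al' al be'} H^al' H^be',  C^al_{al al'} H^al',  B^al_al *)
Definition weylHH : scalar :=
  trace h (fun al be =>
    eval4 (weyl g) (tangent al) meanH (tangent be) meanH).

Definition cottonH : scalar :=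
  trace h (fun al be => eval3 (cotton g) (tangent al) (tangent be) meanH).

Definition trBach : scalar :=
  trace h (fun al be => eval2 (bach g) (tangent al) (tangent be)).

Definition extQ2 : scalar := fun u => trP u + kk / 2 * normH2 u.

Definition extP2 (f : scalar) : scalar := fun u =>
  - laplacian h f u + (kk - 2) / 2 * extQ2 u * f u.

Definition extT (al be : 'I_k) : scalar := fun u =>
  4 * schoutenTT al be u + 4 * inner meanH (sff al be) u
  - ((kk - 2) * trP u + 2^-1 * (kk ^+ 2 - 2 * kk + 4) * normH2 u) * h u al be.

Definition extQ4 : scalar := fun u =>
  let A al be : scalar := fun v =>
    schoutenTT al be v + inner meanH (sff al be) v
    - 2^-1 * normH2 v * h v al be in
  let E al j : scalar := fun v =>
    schoutenTN al j v - lower (nabla_normal al meanH) j v in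
  - laplacian h extQ2 u - 2 * inner2 h A A u + 2 * normTN2 E u
  + kk / 2 * extQ2 u ^+ 2
  - 2 * weylHH u - 4 * cottonH u - 2 / (n%:R - 4) * trBach u.

Definition extP4 (f : scalar) : scalar := fun u =>
  laplacian h (laplacian h f) u + div_grad h extT f u
  + (kk - 4) / 2 * extQ4 u * f u.

(* L0_{al ga al'} L0_be^{ga al'} *)
Definition sff0_sq (al be : 'I_k) : scalar := fun u =>
  \sum_ga \sum_de ginv h ga de u * inner (sff0 al ga) (sff0 be de) u.

(* W_{al ga be}^ga *)
Definition weylTT (al be : 'I_k) : scalar :=
  trace h (fun ga de =>
    eval4 (weyl g) (tangent al) (tangent ga) (tangent be) (tangent de)).

Definition extG : scalar := fun u =>
  (2 * (kk - 1))^-1 * (trace h sff0_sq u - trace h weylTT u).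

Definition fialkow (al be : 'I_k) : scalar := fun u =>
  (kk - 2)^-1 * (sff0_sq al be u - weylTT al be u - extG u * h u al be).

Definition extD (al : 'I_k) (j : 'I_n) : scalar := fun u =>
  (1 - kk)^-1 *
  (\sum_be \sum_ga ginv h be ga u * lower (nabla_sff0 ga al be) j u
   + trace h (fun be ga => eval4 (weyl g)
       (tangent al) (tangent be) (normal_coord j) (tangent ga)) u).

Definition tildeT (al be : 'I_k) : scalar := fun u =>
  4 * fialkow al be u - (kk - 2) * extG u * h u al be.

Definition tildeQ4 : scalar := fun u =>
  - laplacian h extG u - 2 * inner2 h fialkow fialkow u
  + kk / 2 * extG u ^+ 2 - 4 * inner2 h fialkow (schouten h) u
  + kk * extG u * schoutenJ h u + 2 * normTN2 extD u
  - 2 * weylHH u - 4 * cottonH u - 2 / (n%:R - 4) * trBach u.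

End Extrinsic.

(* Main.v *)
(* Along the submanifold, the covariant derivative of the tangent fields splits
   as nabla_al X_be = Gamma^ga_{al be} X_ga + L_{al be}, with Gamma the
   Levi-Civita connection of the induced metric.  Differentiating once more and
   commuting the derivatives gives the Gauss equation (tangential part) and the
   Codazzi equation (normal part).  One trace of Gauss gives
     P_{al be} + H.L_{al be} - |H|^2 h_{al be} / 2 = Pbar_{al be} + F_{al be},
   two traces give tr P + k |H|^2 / 2 = Jbar + G, and one trace of Codazzi gives
   P_{al al'} - nabla_al H_al' = D_{al al'}.  Substituting these
   three identities in T and Q_4 and expanding the squares proves the theorem. *)

Require Import Defs.
From HB Require Import structures.
From mathcomp Require Import all_boot all_order all_algebra.
From mathcomp Require Import all_classical all_reals all_analysis.
From mathcomp Require Import ring lra.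
Import Order.TTheory GRing.Theory Num.Theory.
Import numFieldNormedType.Exports.
Local Open Scope classical_set_scope.
Local Open Scope ring_scope.

(** * Symmetry of second derivatives *)

(** The Gauss equation relates Riemann tensors, whereas T and Q_4 are written with Schouten tensors
    and the trace-free part of [L]. Rewriting ambient curvature as Weyl plus Schouten, and [L] as
    trace-free part plus [H], before tracing is what produces the factors k - 2 and k - 1 that are
    then divided out. The terms with W(H,H), the Cotton tensor and the Bach tensor occur identically
    in [extQ4] and [tildeQ4], so nothing has to be known about them. An identity may be
    differentiated only where it holds on an open set; the local results therefore fix an open [U],
    and the Laplacian and [div_grad] receive identities valid on all of [U]. The normal bundle gets
    no frame: a normal index is a pairing with [normal_coord j], and self-adjointness of the normal
    projection translates between this encoding and actual normal vectors. *)

Section NormedSpace.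
Context {R : realType} {V : normedModType R}.

Lemma near_eq_differentiable (f g : V -> R) (x : V) :
  (\near x, f x = g x) -> differentiable f x -> differentiable g x.
Proof.
move=> fg /diff_locallyP [cdf df].
(* The first-order expansion of [f] is also one of [g], with the same linear part; uniqueness of the
   differential then gives the claim. *)
have gE : g \o shift x = cst (g x) + 'd f x +o_ 0 id.
  apply/eqaddoP => e e0; have /eqaddoP /(_ e e0) fo := df.
  move: (fg); rewrite (near_shift 0 x) subr0 => fg0.
  near=> y.
  have <- : (f \o shift x - (cst (f x) + 'd f x)) y =
    (g \o shift x - (cst (g x) + 'd f x)) y.
    rewrite !fctE /=; congr (_ - (_ + _)); last exact: nbhs_singleton fg.
    by near: y.
  by near: y.
have dE := diff_unique cdf gE.
by apply/diff_locallyP; rewrite dE.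
Unshelve. all: by end_near. Qed.

Lemma is_derive_line (f : V -> R) (y v : V) (s : R) :
  differentiable f (y + s *: v) ->
  is_derive s 1 (fun s => f (y + s *: v)) ('D_v f (y + s *: v)).
Proof.
move=> df.
have da : is_diff s (fun s : R => y + s *: v) (fun s => s *: v).
  by apply: is_diff_eq; rewrite add0r.
have dc : is_diff s (f \o fun s : R => y + s *: v)
   ('d f (y + s *: v) \o fun s => s *: v).
  by apply: is_diff_comp; apply: differentiableP.
apply: DeriveDef; first exact: diff_derivable.
by rewrite deriveE // diff_val /= scale1r deriveE.
Qed.

(* Both orders of differentiation are limits of the same second difference
   [f (x + t v + t w) - f (x + t v) - f (x + t w) + f x], divided by [t ^ 2]. *)
Lemma second_difference (f : V -> R) (x v w : V) :
  (\near x, differentiable f x) -> differentiable ('D_v f) x ->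
  forall e : R, 0 < e -> \forall t \near 0^'+,
    `|f (x + t *: v + t *: w) - f (x + t *: v) - f (x + t *: w) + f x
      - t ^+ 2 * 'D_w ('D_v f) x| <= t ^+ 2 * (e * (2 * `|v| + `|w|)).
Proof.
move=> df dvf e e0.
have [cA /eqaddoP /(_ e e0) fo] := iffLR (diff_locallyP _ _) dvf.
move: df; rewrite (near_shift 0 x) subr0 => df.
have /nbhs_ballP [d /= d0 dP] : nbhs (0 : V) (fun y => differentiable f (y + x)
  /\
  `|('D_v f \o shift x - (cst ('D_v f x) + 'd ('D_v f) x)) y| <= e * `|y|).
  by apply: filterS2 df fo => y.
have N0 : 0 < `|v| + `|w| + 1 by rewrite ltr_wpDl // addr_ge0.
have small t : 0 < t -> t < d / (`|v| + `|w| + 1) ->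
    forall s, 0 <= s <= t -> ball 0 d (s *: v + t *: w) /\ ball 0 d (s *: v).
  move=> t0; rewrite ltr_pdivlMr // => td s /andP[s0 st].
  have h1 : `|s *: v| <= t * `|v| by rewrite normrZ ger0_norm // ler_wpM2r.
  have h2 : `|t *: w| = t * `|w| by rewrite normrZ gtr0_norm.
  have tw : 0 <= t * `|w| by rewrite mulr_ge0 // ltW.
  rewrite -!ball_normE /= !sub0r !normrN; split.
    by apply: le_lt_trans (ler_normD _ _) _; lra.
  by apply: le_lt_trans h1 _; lra.
near=> t.
have t0 : 0 < t by near: t; exact: nbhs_right_gt.
have td : t < d / (`|v| + `|w| + 1) by near: t; apply: nbhs_right_lt; rewrite
  divr_gt0.
(* The second difference is the increment of [psi] over [0, t], so the mean value theorem turns it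
   into [dpsi c * t]; only ['D_v f] then needs an expansion at [x]. *)
pose psi s : R := f (x + t *: w + s *: v) - f (x + s *: v).
pose dpsi s : R := 'D_v f (x + t *: w + s *: v) - 'D_v f (x + s *: v).
have dP' s : 0 <= s <= t -> is_derive s 1 psi (dpsi s).
  move=> /(small t t0 td) [/dP [b1 _] /dP [b2 _]].
  apply: is_deriveB; apply: is_derive_line.
    by move: b1; rewrite /= addrC -addrA [s *: v + _]addrC.
  by move: b2; rewrite /= addrC.
have [|c|c cI] := @MVT_segment R psi dpsi 0 t (ltW t0).
- move=> s; rewrite in_itv /= => /andP[s0 st]; apply: dP'.
  by rewrite (ltW s0) (ltW st).
- apply: derivable_within_continuous => s; rewrite in_itv /= => /dP' h.
  exact: ex_derive.
rewrite /psi !scale0r !addr0 subr0 => Ec.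
have /(small t t0 td) [/dP [_ /=] b1 /dP [_ /=] b2] : 0 <= c <= t by move: cI;
  rewrite in_itv.
rewrite !fctE /= in b1 b2.
pose A : V -> R := 'd ('D_v f) x.
have AZ : A (t *: w) = t * A w by rewrite /A linearZ.
have AD : A (c *: v + t *: w) = A (c *: v) + A (t *: w) by rewrite /A linearD.
have -> : f (x + t *: v + t *: w) - f (x + t *: v) - f (x + t *: w) + f x =
   dpsi c * t.
  by rewrite -Ec (addrAC x) opprB addrA [RHS]addrAC.
have -> : 'D_w ('D_v f) x = A w by rewrite /A deriveE.
rewrite -!/(A _) in b1 b2.
(* The two affine expansions differ by [t * A w] alone. Their errors are at most [e] times the norms
   of [c *: v + t *: w] and [c *: v], whence the constant [2 * |v| + |w|]. *)
have -> : dpsi c * t - t ^+ 2 * A w =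
  t * (('D_v f (c *: v + t *: w + x) - ('D_v f x + A (c *: v + t *: w)))
     - ('D_v f (c *: v + x) - ('D_v f x + A (c *: v)))).
  rewrite /dpsi AD AZ.
  rewrite [c *: v + t *: w + x]addrC [c *: v + t *: w]addrC addrA [c *: v +
    x]addrC.
  have alg (p q r A1 A2 : R) : (p - q) * t - t ^+ 2 * A2 =
    t * ((p - (r + (A1 + t * A2))) - (q - (r + A1))) by ring.
  exact: alg.
rewrite normrM (gtr0_norm t0) expr2 -!mulrA ler_pM2l //.
apply: le_trans (ler_normB _ _) _; apply: le_trans (lerD b1 b2) _.
rewrite -mulrDr mulrCA ler_pM2l //.
have [c0 ct] : 0 <= c /\ c <= t by apply/andP; move: cI; rewrite in_itv.
have h1 : `|c *: v| <= t * `|v| by rewrite normrZ ger0_norm // ler_wpM2r.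
have h2 : `|t *: w| = t * `|w| by rewrite normrZ gtr0_norm.
by have := ler_normD (c *: v) (t *: w); lra.
Unshelve. all: by end_near. Qed.

(** The second difference is unchanged when the directions are exchanged, which swaps [q] and [r];
    both mixed derivatives thus approximate the same number, and the factor [T] (used as [t ^ 2])
    cancels. *)
Lemma dist_from_second_differences (p q r s X Y T a b : R) : 0 < T ->
  `|p - q - r + s - T * X| <= T * a -> `|p - r - q + s - T * Y| <= T * b ->
  `|X - Y| <= a + b.
Proof.
move=> T0 h1 h2; rewrite -(ler_pM2l T0) -{1}(gtr0_norm T0) -normrM.
have -> : T * (X - Y) = (p - r - q + s - T * Y) - (p - q - r + s - T * X).
  by ring.
by apply: le_trans (ler_normB _ _) _; rewrite mulrDr addrC lerD.
Qed.

(** Young's form of the symmetry theorem: differentiability of the first derivatives at the single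
    point [x] replaces continuity of the second derivatives. *)
Lemma derive_comm (f : V -> R) (x v w : V) :
  (\near x, differentiable f x) ->
  differentiable ('D_v f) x -> differentiable ('D_w f) x ->
  'D_w ('D_v f) x = 'D_v ('D_w f) x.
Proof.
move=> df dv dw; apply/eqP; rewrite -subr_eq0 -normr_le0.
apply/ler_addgt0Pl => e e0; rewrite addr0.
(* [N] is the sum of the two error constants; the added 1 keeps it positive when both directions
   vanish. *)
set N := 2 * `|v| + `|w| + (2 * `|w| + `|v|) + 1.
have N0 : 0 < N by rewrite /N; have := normr_ge0 v; have := normr_ge0 w; lra.
have h1 := second_difference f x v w df dv (e / N) (divr_gt0 e0 N0).
have h2 := second_difference f x w v df dw (e / N) (divr_gt0 e0 N0).
have [t [[t0 a1] a2]] := filter_ex (filterI (filterI (nbhs_right_gt 0) h1) h2).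
rewrite /= in a1 a2 t0; rewrite (addrAC x) in a2.
have := dist_from_second_differences _ _ _ _ _ _ _ _ _ (exprn_gt0 2 t0) a1 a2.
move=> /le_trans; apply.
rewrite -mulrDr -mulrA ler_piMr //; first exact: ltW.
by rewrite ler_pdivrMl // mulr1 /N lerDl ler01.
Qed.

End NormedSpace.

(** * Smooth functions of several variables *)

Section Smooth.
Context {R : realType} {n : nat}.
Implicit Types (U : set 'rV[R]_n) (f g : 'rV[R]_n -> R) (x : 'rV[R]_n).

Lemma eq_pd U f g i : open U -> (forall x, U x -> f x = g x) ->
  forall x, U x -> pd i f x = pd i g x.
Proof.
move=> oU fg x Ux; apply: near_eq_derive.
by apply: filterS (open_nbhs_nbhs (conj oU Ux)).
Qed.

Lemma pd_cst (c : R) i x : pd i (fun=> c) x = 0.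
Proof. by rewrite /pd derive_cst. Qed.

Lemma pdD f g i x : differentiable f x -> differentiable g x ->
  pd i (fun y => f y + g y) x = pd i f x + pd i g x.
Proof. by move=> df dg; rewrite /pd -deriveD //; exact: diff_derivable. Qed.

Lemma pdM f g i x : differentiable f x -> differentiable g x ->
  pd i (fun y => f y * g y) x = pd i f x * g x + f x * pd i g x.
Proof.
move=> /(@diff_derivable _ _ _ _ _ (delta_mx 0 i)) df.
move=> /(@diff_derivable _ _ _ _ _ (delta_mx 0 i)) dg.
rewrite addrC [X in _ = _ + X]mulrC; exact: (deriveM df dg).
Qed.

Lemma pdN f i x : differentiable f x -> pd i (fun y => - f y) x = - pd i f x.
Proof. by move=> df; rewrite /pd -deriveN //; exact: diff_derivable. Qed.

Lemma pdV f i x : differentiable f x -> f x != 0 ->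
  pd i (fun y => (f y)^-1) x = - (pd i f x * ((f x)^-1 * (f x)^-1)).
Proof.
move=> /(@diff_derivable _ _ _ _ _ (delta_mx 0 i)) df f0.
by rewrite mulrC -mulNr -invfM -expr2; exact: (deriveV f0 df).
Qed.

(** Differentiability and the formula are proved together because each induction step applies the
    sum rule to the tail, which must be differentiable. *)
Lemma is_pd_sum (I : Type) (r : seq I) (P : pred I) (F : I -> 'rV[R]_n -> R) i
  x :
  (forall j, differentiable (F j) x) ->
  differentiable (fun y => \sum_(j <- r | P j) F j y) x /\
  pd i (fun y => \sum_(j <- r | P j) F j y) x = \sum_(j <- r | P j) pd i (F j)
    x.
Proof.
move=> dF; elim: r => [|j r [IHd IH]].
  have E : (fun y => \sum_(j <- [::] | P j) F j y) = cst 0.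
    by apply/funext => y; rewrite big_nil.
  rewrite E big_nil pd_cst; split => //; exact: differentiable_cst.
case Pj : (P j).
  have E : (fun y => \sum_(j <- j :: r | P j) F j y) =
      (fun y => F j y + \sum_(j <- r | P j) F j y).
    by apply/funext => y; rewrite big_cons Pj.
  by rewrite E big_cons Pj pdD // IH; split => //; exact: differentiableD.
have E : (fun y => \sum_(j <- j :: r | P j) F j y) =
    (fun y => \sum_(j <- r | P j) F j y).
  by apply/funext => y; rewrite big_cons Pj.
by rewrite E big_cons Pj.
Qed.

Lemma pd_sum (I : Type) (r : seq I) (P : pred I) (F : I -> 'rV[R]_n -> R) i x :
  (forall j, differentiable (F j) x) ->
  pd i (fun y => \sum_(j <- r | P j) F j y) x = \sum_(j <- r | P j) pd i (F j)
    x.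
Proof. by move=> dF; have [] := is_pd_sum I r P F i x dF. Qed.

(* [smooth] with the order of differentiation made explicit, for inductions
   where the first derivative has to be peeled off (product and chain rules). *)
Fixpoint Cm (m : nat) U f : Prop :=
  (forall x, U x -> differentiable f x) /\
  if m is m'.+1 then forall i, Cm m' U (pd i f) else True.

Lemma Cm_diff m U f : Cm m U f -> forall x, U x -> differentiable f x.
Proof. by case: m => [|m] []. Qed.

Lemma smoothP U f : smooth U f <-> forall m, Cm m U f.
Proof.
split=> [sf m|cf s x Ux].
  elim: m f sf => [|m IH] f sf /=; split => //; try exact: (sf [::]).
  (* [foldr] applies the last entry of the list first, so [rcons] isolates the innermost
     derivative. *)
  by move=> i; apply: IH => s x Ux; have := sf (rcons s i) x Ux; rewrite
    foldr_rcons.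
elim/last_ind: s f cf => [|s i IH] f cf; first exact: Cm_diff (cf 0%N) _ Ux.
by rewrite foldr_rcons; apply: IH => m; have [_ /(_ i)] := cf m.+1.
Qed.

Lemma smooth_diff U f x : smooth U f -> U x -> differentiable f x.
Proof. by move=> sf; exact: (sf [::]). Qed.

Lemma smooth_pd U f i : smooth U f -> smooth U (pd i f).
Proof. by move=> sf s x Ux; have := sf (rcons s i) x Ux; rewrite foldr_rcons.
  Qed.

Lemma smooth_sub U W f : W `<=` U -> smooth U f -> smooth W f.
Proof. by move=> WU sf s x /WU; exact: sf. Qed.

Lemma CmS m U f : Cm m.+1 U f -> Cm m U f.
Proof.
elim: m f => [|m IH] f /= [df cf]; split => // i.
exact: (IH _ (cf i)).
Qed.

Lemma eq_Cm m U f g : open U -> (forall x, U x -> f x = g x) -> Cm m U f -> Cm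
  m U g.
Proof.
move=> oU; elim: m f g => [|m IH] f g fg /= [df cf]; split => //.
- move=> x Ux; apply: near_eq_differentiable (df x Ux).
  by apply: filterS (open_nbhs_nbhs (conj oU Ux)).
- move=> x Ux; apply: near_eq_differentiable (df x Ux).
  by apply: filterS (open_nbhs_nbhs (conj oU Ux)).
- by move=> i; apply: IH (cf i); exact: eq_pd.
Qed.

Lemma eq_smooth U f g : open U -> (forall x, U x -> f x = g x) ->
  smooth U f -> smooth U g.
Proof. by move=> oU fg /smoothP cf; apply/smoothP => m; exact: eq_Cm (cf m).
  Qed.

Lemma Cm_cst m U (c : R) : Cm m U (fun=> c).
Proof.
elim: m c => [|m IH] c; split => //.
move=> i; rewrite (_ : pd i _ = fun=> 0) //; apply/funext => x; exact: pd_cst.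
Qed.

Lemma CmD m U f g : open U -> Cm m U f -> Cm m U g -> Cm m U (fun y => f y + g
  y).
Proof.
move=> oU; elim: m f g => [|m IH] f g [df cf] [dg cg]; split => //.
- by move=> x Ux; apply: differentiableD; [exact: df|exact: dg].
- by move=> x Ux; apply: differentiableD; [exact: df|exact: dg].
move=> i; apply: (eq_Cm m U _ _ oU _ (IH _ _ (cf i) (cg i))) => x Ux.
by rewrite pdD //; [exact: df|exact: dg].
Qed.

Lemma CmM m U f g : open U -> Cm m U f -> Cm m U g -> Cm m U (fun y => f y * g
  y).
Proof.
move=> oU; elim: m f g => [|m IH] f g Cf Cg.
  by split => // x Ux; apply: differentiableM; [exact: Cf.1|exact: Cg.1].
have [df cf] := Cf; have [dg cg] := Cg; split.
  by move=> x Ux; apply: differentiableM; [exact: df|exact: dg].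
move=> i; have := CmD m U _ _ oU (IH _ _ (cf i) (CmS _ _ _ Cg)) (IH _ _ (CmS _
  _ _ Cf) (cg i)).
by apply: eq_Cm => // x Ux; rewrite pdM //; [exact: df|exact: dg].
Qed.

Lemma CmV m U f : open U -> (forall x, U x -> f x != 0) ->
  Cm m U f -> Cm m U (fun y => (f y)^-1).
Proof.
move=> oU f0; elim: m => [|m IH] Cf.
  by split => // x Ux; apply: differentiableV; [exact: Cf.1|exact: f0].
have [df cf] := Cf; split.
  by move=> x Ux; apply: differentiableV; [exact: df|exact: f0].
move=> i; have CV := IH (CmS _ _ _ Cf).
have := CmM m U _ _ oU (Cm_cst m U (-1)) (CmM m U _ _ oU (cf i) (CmM m U _ _ oU
  CV CV)).
by apply: eq_Cm => // x Ux; rewrite pdV ?mulN1r //; [exact: df|exact: f0].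
Qed.

Lemma smooth_cst U (c : R) : smooth U (fun=> c).
Proof. by apply/smoothP => m; exact: Cm_cst. Qed.

Lemma smoothD U f g : open U -> smooth U f -> smooth U g ->
  smooth U (fun y => f y + g y).
Proof.
by move=> oU /smoothP cf /smoothP cg; apply/smoothP => m; exact: CmD.
Qed.

Lemma smoothM U f g : open U -> smooth U f -> smooth U g ->
  smooth U (fun y => f y * g y).
Proof.
by move=> oU /smoothP cf /smoothP cg; apply/smoothP => m; exact: CmM.
Qed.

Lemma smoothN U f : open U -> smooth U f -> smooth U (fun y => - f y).
Proof.
move=> oU sf; have := smoothM U _ _ oU (smooth_cst U (-1)) sf.
by apply: eq_smooth => // x _; rewrite mulN1r.
Qed.

Lemma smoothV U f : open U -> (forall x, U x -> f x != 0) -> smooth U f ->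
  smooth U (fun y => (f y)^-1).
Proof. by move=> oU f0 /smoothP cf; apply/smoothP => m; exact: CmV. Qed.

Lemma smooth_sum U (I : Type) (r : seq I) (P : pred I) (F : I -> 'rV[R]_n -> R)
  :
  open U -> (forall j, smooth U (F j)) ->
  smooth U (fun y => \sum_(j <- r | P j) F j y).
Proof.
move=> oU sF; elim: r => [|j r IH].
  by apply: eq_smooth (smooth_cst U 0) => // x _; rewrite big_nil.
case Pj : (P j).
  by apply: eq_smooth (smoothD U _ _ oU (sF j) IH) => // x _; rewrite big_cons
    Pj.
by apply: eq_smooth IH => // x _; rewrite big_cons Pj.
Qed.

Lemma smooth_prod U (I : Type) (r : seq I) (P : pred I) (F : I -> 'rV[R]_n ->
  R) :
  open U -> (forall j, smooth U (F j)) ->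
  smooth U (fun y => \prod_(j <- r | P j) F j y).
Proof.
move=> oU sF; elim: r => [|j r IH].
  by apply: eq_smooth (smooth_cst U 1) => // x _; rewrite big_nil.
case Pj : (P j).
  by apply: eq_smooth (smoothM U _ _ oU (sF j) IH) => // x _; rewrite big_cons
    Pj.
by apply: eq_smooth IH => // x _; rewrite big_cons Pj.
Qed.

Lemma smooth_det U m (A : 'rV[R]_n -> 'M[R]_m) : open U ->
  (forall i j, smooth U (fun x => A x i j)) -> smooth U (fun x => \det (A x)).
Proof.
move=> oU sA; apply: smooth_sum => // s; apply: smoothM => //.
  exact: smooth_cst.
exact: smooth_prod.
Qed.

(** By Cramer's rule the entries are cofactors divided by a determinant that does not vanish on
    [U]. *)
Lemma smooth_invmx U m (A : 'rV[R]_n -> 'M[R]_m) i j : open U ->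
  (forall i j, smooth U (fun x => A x i j)) ->
  (forall x, U x -> A x \in unitmx) -> smooth U (fun x => invmx (A x) i j).
Proof.
move=> oU sA uA.
suff : smooth U (fun x => (\det (A x))^-1 * cofactor (A x) j i).
  by apply: eq_smooth => // x Ux; rewrite /invmx uA // !mxE.
apply: smoothM => //; first apply: smoothV => //.
- by move=> x /uA; rewrite unitmxE unitfE.
- exact: smooth_det.
apply: smoothM => //; first exact: smooth_cst.
apply: smooth_det => // p q.
by apply: eq_smooth (sA (lift j p) (lift i q)) => // x _; rewrite !mxE.
Qed.

Lemma pdC U f i j x : open U -> smooth U f -> U x ->
  pd i (pd j f) x = pd j (pd i f) x.
Proof.
move=> oU sf Ux; apply: derive_comm.
- apply: filterS (open_nbhs_nbhs (conj oU Ux)) => y Uy.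
  exact: smooth_diff sf Uy.
- exact: smooth_diff (smooth_pd U f j sf) Ux.
- exact: smooth_diff (smooth_pd U f i sf) Ux.
Qed.

End Smooth.

Section ChainRule.
Context {R : realType} {n m : nat}.
Implicit Types (F : 'rV[R]_n -> 'rV[R]_m) (f : 'rV[R]_m -> R) (x : 'rV[R]_n).

Lemma differentiable_rV F x : (forall i, differentiable (fun y => F y 0 i) x) ->
  differentiable F x.
Proof.
move=> dF; have -> : F = \sum_(i < m) (fun y => F y 0 i *: delta_mx 0 i).
  apply/funext => y; rewrite fct_sumE [LHS]row_sum_delta.
  by apply: eq_bigr.
by apply: differentiable_sum => i; apply: differentiableZl.
Qed.

Lemma jacobianE F x i j : (forall i, differentiable (fun y => F y 0 i) x) ->
  'J F x i j = pd i (fun y => F y 0 j) x.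
Proof.
move=> dF; have dFx := differentiable_rV F x dF.
have := @deriveEjacobian R n m F x (delta_mx 0 i) dFx.
rewrite -rowE derive_mx; last exact: diff_derivable.
by move=> /matrixP /(_ 0 j); rewrite !mxE.
Qed.

Lemma pd_comp F f x i : (forall i, differentiable (fun y => F y 0 i) x) ->
  differentiable f (F x) ->
  differentiable (f \o F) x /\
  pd i (f \o F) x = \sum_j pd j f (F x) * 'J F x i j.
Proof.
move=> dF df; have dFx := differentiable_rV F x dF.
split; first exact: differentiable_comp.
rewrite /pd deriveE; last exact: differentiable_comp.
rewrite diff_comp //= -[X in 'd f _ X](deriveE _ dFx) deriveEjacobian // -rowE.
rewrite [X in 'd f _ X]row_sum_delta linear_sum; apply: eq_bigr => j _.
by rewrite linearZ /= mxE deriveE // mulrC.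
Qed.

(** Induction on the order, for all [f] at once: the chain rule replaces [f] by its partial
    derivatives, which need one order less, multiplied by derivatives of the components of [F]. *)
Lemma smooth_comp (U : set 'rV[R]_n) (V : set 'rV[R]_m) F f : open U ->
  smooth_map U F -> (forall x, U x -> V (F x)) -> smooth V f ->
  smooth U (fun x => f (F x)).
Proof.
move=> oU sF UV /smoothP sf; apply/smoothP => p.
have dF x i : U x -> differentiable (fun y => F y 0 i) x.
  by move=> Ux; exact: smooth_diff (sF i) Ux.
elim: p f sf => [|p IH] f sf; split => //.
- move=> x Ux; apply: differentiable_comp; first exact: differentiable_rV (dF x
  ^~ Ux).
  exact: Cm_diff (sf 0%N) _ (UV _ Ux).
- move=> x Ux; apply: differentiable_comp; first exact: differentiable_rV (dF x
  ^~ Ux).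
  exact: Cm_diff (sf 0%N) _ (UV _ Ux).
move=> i.
have : Cm p U (fun x => \sum_j pd j f (F x) * pd i (fun y => F y 0 j) x).
  pose G (j : 'I_m) x := pd j f (F x) * pd i (fun y => F y 0 j) x.
  have CG j : Cm p U (G j).
    apply: CmM => //; first by apply: IH => q; have [_ /(_ j)] := sf q.+1.
    by have /smoothP := smooth_pd _ _ i (sF j).
  rewrite -/(fun x => \sum_j G j x); elim: (index_enum _) => [|j r IHr].
    by apply: eq_Cm (Cm_cst p U 0) => // x _; rewrite big_nil.
  by apply: eq_Cm (CmD p U _ _ oU (CG j) IHr) => // x _; rewrite big_cons.
apply: eq_Cm => // x Ux; rewrite (pd_comp F f x i _ _).2.
- by apply: eq_bigr => j _; rewrite jacobianE // => q; exact: dF.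
- by move=> q; exact: dF.
- exact: Cm_diff (sf 0%N) _ (UV _ Ux).
Qed.

End ChainRule.

(** * Riemannian metrics in coordinates *)

(** The second-order patterns see through the binder of the point. Leaves are closed by [done] from
    the context, which is why smoothness facts are recorded below with [Let]. *)
Ltac smooth_step :=
  match goal with
  | |- smooth _ (fun x => ?c) => exact: smooth_cst
  | |- smooth _ (fun x => @?f x + @?g x) => apply: (@smoothD _ _ _ f g)
  | |- smooth _ (fun x => - @?f x) => apply: (@smoothN _ _ _ f)
  | |- smooth _ (fun x => @?f x * @?g x) => apply: (@smoothM _ _ _ f g)
  | |- smooth _ (fun x => @bigop.body _ _ _ _ (@?b x)) =>
      apply: smooth_sum; last move=> ?
  | |- smooth _ (fun x => pd _ _ x) => apply: smooth_pd
  | |- smooth _ (pd _ _) => apply: smooth_pd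
  end; rewrite /=.
Ltac smooth_tac := repeat (first [done | smooth_step]).

Section Sums.
Context {R : comNzRingType} {n : nat}.

Lemma sum_delta (f : 'I_n -> R) i : \sum_j (i == j)%:R * f j = f i.
Proof.
rewrite (bigD1 i) //= eqxx mul1r big1 ?addr0 // => j /negPf.
by rewrite eq_sym => ->; rewrite mul0r.
Qed.

End Sums.

Section Metric.
Context {R : realType} {n : nat}.
Implicit Types (U : set 'rV[R]_n) (g : 'rV[R]_n -> 'M[R]_n).

(** The local content of a Riemannian metric. Both the ambient metric in a chart and the induced
    metric satisfy it, so each lemma of this section serves twice. *)
Definition metric_on U g := [/\ open U,
  forall i j, smooth U (fun x => g x i j),
  forall x, U x -> (g x)^T = g x &
  forall x, U x -> forall v : 'rV[R]_n, v != 0 -> 0 < (v *m g x *m v^T) 0 0].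

(** Christoffel symbols of the first kind, the lowered index coming first. *)
Definition christoffel1 g (i j k : 'I_n) : 'rV[R]_n -> R := fun x =>
  2^-1 * (pd j (fun y => g y i k) x + pd k (fun y => g y i j) x
          - pd i (fun y => g y j k) x).

Variables (U : set 'rV[R]_n) (g : 'rV[R]_n -> 'M[R]_n).
Hypothesis mg : metric_on U g.

Lemma metric_open : open U. Proof. by case: mg. Qed.

Lemma smooth_metric i j : smooth U (fun x => g x i j).
Proof. by case: mg. Qed.

Lemma metricC x i j : U x -> g x i j = g x j i.
Proof. by case: mg => _ _ sg _ /sg gx; rewrite -[in LHS]gx mxE. Qed.

(** A vector in the kernel has length zero, which positivity excludes unless it vanishes. *)
Lemma metric_unit x : U x -> g x \in unitmx.
Proof.
case: mg => _ _ _ pg Ux; rewrite -row_free_unit; apply/row_freeP.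
have /row_freeP // : row_free (g x).
rewrite -kermx_eq0; apply/eqP/row_matrixP => i; rewrite row0.
have /(congr1 (row i)) := mulmx_ker (g x).
rewrite row_mul row0 => vg; apply/eqP/negPn/negP => /(pg x Ux).
by rewrite vg mul0mx mxE ltxx.
Qed.

Lemma ginvC x i j : U x -> ginv g i j x = ginv g j i x.
Proof.
case: mg => _ _ sg _ /sg gx.
by rewrite /ginv -[in LHS]gx -trmx_inv mxE.
Qed.

Lemma ginv_metric x i k : U x -> \sum_j ginv g i j x * g x j k = (i == k)%:R.
Proof.
move=> /metric_unit /mulVmx /matrixP /(_ i k).
by rewrite !mxE.
Qed.

Lemma metric_ginv x i k : U x -> \sum_j g x i j * ginv g j k x = (i == k)%:R.
Proof.
move=> /metric_unit /mulmxV /matrixP /(_ i k).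
by rewrite !mxE.
Qed.

Lemma raise_lower x (f : 'I_n -> R) i : U x ->
  \sum_j ginv g i j x * (\sum_k g x j k * f k) = f i.
Proof.
move=> Ux; under eq_bigr do rewrite big_distrr /=.
rewrite exchange_big /= -[RHS](sum_delta f); apply: eq_bigr => k _.
by rewrite -(ginv_metric x) // big_distrl; apply: eq_bigr => j _; rewrite mulrA.
Qed.

Lemma lower_raise x (f : 'I_n -> R) i : U x ->
  \sum_j g x i j * (\sum_k ginv g j k x * f k) = f i.
Proof.
move=> Ux; under eq_bigr do rewrite big_distrr /=.
rewrite exchange_big /= -[RHS](sum_delta f); apply: eq_bigr => k _.
by rewrite -(metric_ginv x) // big_distrl; apply: eq_bigr => j _; rewrite mulrA.
Qed.

Lemma smooth_ginv i j : smooth U (ginv g i j).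
Proof.
rewrite /ginv; apply: smooth_invmx; [exact: metric_open | exact: smooth_metric
  |].
exact: metric_unit.
Qed.

Let oU := metric_open.
Let sg := smooth_metric.
Let sgi := smooth_ginv.

Lemma smooth_christoffel i j k : smooth U (christoffel g i j k).
Proof. rewrite /christoffel; smooth_tac. Qed.

Lemma smooth_christoffel1 i j k : smooth U (christoffel1 g i j k).
Proof. by rewrite /christoffel1; smooth_tac. Qed.

Let sch := smooth_christoffel.
Let sch1 := smooth_christoffel1.

Lemma pd_metricC x i j k : U x -> pd k (fun y => g y i j) x = pd k (fun y => g
  y j i) x.
Proof. by move: x; apply: eq_pd => // x; exact: metricC. Qed.

Lemma christoffelC x i j k : U x -> christoffel g i j k x = christoffel g i k j
  x.
Proof.
move=> Ux; rewrite /christoffel; congr (_ * _); apply: eq_bigr => m _.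
by rewrite (pd_metricC x j k) // [X in X - _]addrC.
Qed.

Lemma christoffel1C x i j k : U x -> christoffel1 g i j k x = christoffel1 g i
  k j x.
Proof.
move=> Ux; rewrite /christoffel1; congr (_ * _).
by rewrite (pd_metricC x j k) // [X in X - _]addrC.
Qed.

Lemma christoffelE x i j k :
  christoffel g i j k x = \sum_m ginv g i m x * christoffel1 g m j k x.
Proof.
rewrite /christoffel big_distrr; apply: eq_bigr => m _.
by rewrite /christoffel1 mulrCA.
Qed.

Lemma lower_christoffel x i j k : U x ->
  \sum_m g x i m * christoffel g m j k x = christoffel1 g i j k x.
Proof.
move=> Ux; rewrite -[RHS](lower_raise x (fun m => christoffel1 g m j k x) i Ux).
by apply: eq_bigr => m _; rewrite christoffelE.
Qed.

(** Metric compatibility of the Levi-Civita connection, in coordinates. *)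
Lemma pd_metric x i j k : U x ->
  pd k (fun y => g y i j) x = christoffel1 g i k j x + christoffel1 g j k i x.
Proof.
move=> Ux; rewrite /christoffel1 (pd_metricC x k j) // (pd_metricC x k i) //.
rewrite (pd_metricC x j i) //.
by field.
Qed.

Lemma pd_christoffel1 x p a b c : U x -> pd p (christoffel1 g a b c) x = 2^-1 *
    (pd p (pd b (fun y => g y a c)) x + pd p (pd c (fun y => g y a b)) x
     - pd p (pd a (fun y => g y b c)) x).
Proof.
move=> Ux; have dif (f : 'rV[R]_n -> R) (sf : smooth U f) : differentiable f x.
  exact: smooth_diff sf Ux.
rewrite /christoffel1 pdM; try (apply: dif; smooth_tac).
rewrite pd_cst mul0r add0r; congr (_ * _).
rewrite pdD; try (apply: dif; smooth_tac).
rewrite pdD; try (apply: dif; smooth_tac).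
by rewrite pdN //; apply: dif; smooth_tac.
Qed.

(** The inverse metric is parallel: differentiate [ginv * g = 1] and use metric compatibility. This
    later makes the trace commute with covariant differentiation. *)
Lemma pd_ginv x i j a : U x -> pd a (ginv g i j) x =
  - (\sum_m christoffel g i a m x * ginv g m j x)
  - \sum_m christoffel g j a m x * ginv g i m x.
Proof.
move=> Ux.
have dif (f : 'rV[R]_n -> R) (sf : smooth U f) : differentiable f x.
  exact: smooth_diff sf Ux.
have E p q : \sum_m pd a (ginv g p m) x * g x m q =
    - \sum_m ginv g p m x * pd a (fun y => g y m q) x.
  have : pd a (fun y => \sum_m ginv g p m y * g y m q) x = 0.
    rewrite -[RHS](pd_cst ((p == q)%:R) a x); apply: (eq_pd U) => // y Uy.
    by rewrite ginv_metric.
  rewrite pd_sum => [|m]; last by apply: dif; smooth_tac.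
  under eq_bigr do rewrite (pdM _ _ _ _ (dif _ _) (dif _ _)) //.
  by rewrite big_split /= => /eqP; rewrite addr_eq0 => /eqP.
transitivity (\sum_q (\sum_m pd a (ginv g i m) x * g x m q) * ginv g q j x).
  rewrite -[LHS](sum_delta (fun m => pd a (ginv g i m) x) j).
  under [RHS]eq_bigr do rewrite big_distrl.
  rewrite exchange_big /=; apply: eq_bigr => m _.
  under eq_bigr do rewrite -mulrA.
  by rewrite -big_distrr metric_ginv //= mulrC eq_sym.
under eq_bigr => q _.
  rewrite E mulNr big_distrl /=.
  under eq_bigr => m _ do rewrite pd_metric // mulrDr mulrDl.
  rewrite big_split /= -big_distrl -christoffelE //=.
  over.
rewrite sumrN big_split opprD /=; congr (- _ - _).
rewrite exchange_big /=; apply: eq_bigr => m _.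
rewrite christoffelE // big_distrl; apply: eq_bigr => q _ /=.
by rewrite (ginvC x q j) //; ring.
Qed.

(** When the first index is lowered under the derivative, metric compatibility yields terms that
    cancel the quadratic part of [riemann_up] and leaves others of opposite type. In the resulting
    form the symmetries can be read off. *)
Lemma riemannE x i j k l : U x -> riemann g i j k l x =
  pd k (christoffel1 g i l j) x - pd l (christoffel1 g i k j) x
  - \sum_m christoffel1 g m k i x * christoffel g m l j x
  + \sum_m christoffel1 g m l i x * christoffel g m k j x.
Proof.
move=> Ux.
have dif (f : 'rV[R]_n -> R) (sf : smooth U f) : differentiable f x.
  exact: smooth_diff sf Ux.
have E p q r : \sum_m g x i m * pd p (christoffel g m q r) x =
    pd p (christoffel1 g i q r) x
    - \sum_m (christoffel1 g i p m x + christoffel1 g m p i x) * christoffel g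
      m q r x.
  apply/eqP; rewrite eq_sym subr_eq addrC; apply/eqP.
  have -> : pd p (christoffel1 g i q r) x =
      pd p (fun y => \sum_m g y i m * christoffel g m q r y) x.
    by apply: (eq_pd U) => // y Uy; rewrite lower_christoffel.
  rewrite pd_sum => [|m]; last by apply: dif; smooth_tac.
  under eq_bigr do rewrite (pdM _ _ _ _ (dif _ _) (dif _ _)) // pd_metric //.
  by rewrite big_split.
have E2 p q : \sum_m g x i m * (\sum_s christoffel g m p s x * christoffel g s
  q j x)
   = \sum_m christoffel1 g i p m x * christoffel g m q j x.
  under eq_bigr do rewrite big_distrr.
  rewrite exchange_big; apply: eq_bigr => s _ /=.
  by rewrite -lower_christoffel // big_distrl; apply: eq_bigr => m _; rewrite
    mulrA.
rewrite /riemann /riemann_up.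
under eq_bigr do rewrite sumrB mulrDr mulrBr mulrBr.
rewrite big_split /= 2!sumrB.
have split p q : \sum_m (christoffel1 g i p m x + christoffel1 g m p i x)
    * christoffel g m q j x = \sum_m christoffel1 g i p m x * christoffel g m q
      j x
    + \sum_m christoffel1 g m p i x * christoffel g m q j x.
  by rewrite -big_split; apply: eq_bigr => m _; rewrite mulrDl.
move: (E k l j) (E l k j) (E2 k l) (E2 l k) (split k l) (split l k).
move: (christoffel g) (christoffel1 g) (@pd R n) => G G1 D.
by move=> -> -> -> -> -> ->; ring.
Qed.

(** Both sides contract two symbols of the first kind with the symmetric matrix [ginv]. *)
Lemma christoffel_quadC x i j k l : U x ->
  \sum_m christoffel1 g m i j x * christoffel g m k l x =
  \sum_m christoffel1 g m k l x * christoffel g m i j x.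
Proof.
move=> Ux.
under eq_bigr do rewrite christoffelE // big_distrr.
under [RHS]eq_bigr do rewrite christoffelE // big_distrr.
rewrite exchange_big; apply: eq_bigr => p _; apply: eq_bigr => m _ /=.
rewrite (ginvC x m p) //; move: (ginv g) (christoffel1 g) => gi G1; ring.
Qed.

(** In [riemannE] the derivative terms are second derivatives of the metric, which commute, and the
    quadratic terms are symmetric. Antisymmetry in the first pair is then inherited from the second
    pair. *)
Lemma riemann_pairC x i j k l : U x -> riemann g i j k l x = riemann g k l i j
  x.
Proof.
move=> Ux; rewrite (riemannE x i j) // (riemannE x k l) //.
have dif (f : 'rV[R]_n -> R) (sf : smooth U f) : differentiable f x.
  exact: smooth_diff sf Ux.
have E p a b c : pd p (christoffel1 g a b c) x = 2^-1 *
    (pd p (pd b (fun y => g y a c)) x + pd p (pd c (fun y => g y a b)) x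
     - pd p (pd a (fun y => g y b c)) x).
  exact: pd_christoffel1.
have gC p q a b : pd p (pd q (fun y => g y a b)) x = pd p (pd q (fun y => g y b
  a)) x.
  by move: x {dif E} Ux; apply: eq_pd => // y Uy; exact: pd_metricC.
have pC p q a b : pd p (pd q (fun y => g y a b)) x = pd q (pd p (fun y => g y a
  b)) x.
  exact: (pdC U).
have Q a b c d : \sum_m christoffel1 g m a b x * christoffel g m c d x =
    \sum_m christoffel1 g m d c x * christoffel g m b a x.
  rewrite christoffel_quadC //; apply: eq_bigr => m _.
  by rewrite christoffel1C // christoffelC.
move: (Q i k j l) (Q j k i l) (E k i l j) (E l i k j) (E i k j l) (E j k i l).
move: (pC k l i j) (pC k j i l) (pC k i l j) (pC l j i k) (pC l i k j) (pC j i
  k l).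
move: (gC i k l j) (gC j l i k) (christoffel_quadC x l j k i Ux).
(* The analytic terms become variables, so that the rest is an identity between polynomials. *)
move: (christoffel g) (christoffel1 g) (@pd R n) => G G1 D.
move=> g1 g2 q3 p1 p2 p3 p4 p5 p6 q1 q2 e1 e2 e3 e4.
by rewrite q1 q3 q2 e1 e2 e3 e4 p1 p2 p3 p4 p5 p6 g1 g2; ring.
Qed.

Lemma riemannNr x i j k l : riemann g i j k l x = - riemann g i j l k x.
Proof.
rewrite /riemann -sumrN; apply: eq_bigr => m _; rewrite -mulrN; congr (_ * _).
rewrite /riemann_up !sumrB; move: (christoffel g) (@pd R n) => G D.
by ring.
Qed.

Lemma riemannNl x i j k l : U x -> riemann g i j k l x = - riemann g j i k l x.
Proof.
by move=> Ux; rewrite (riemann_pairC x i j k l Ux) (riemannNr x k l i j)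
  (riemann_pairC x k l j i Ux).
Qed.

Lemma riemannNN x i j k l : U x -> riemann g i j k l x = riemann g j i l k x.
Proof. by move=> Ux; rewrite (riemannNl x i j k l Ux) (riemannNr x j i k l)
  opprK. Qed.

Lemma riemann_pairCN x i j k l : U x -> riemann g i j k l x = - riemann g k l j
  i x.
Proof. by move=> Ux; rewrite (riemann_pairC x i j k l Ux) (riemannNr x k l i
  j). Qed.

Lemma ricciE x i j : U x ->
  ricci g i j x = \sum_k \sum_l ginv g k l x * riemann g l i k j x.
Proof. by move=> Ux; apply: eq_bigr => k _; rewrite /riemann raise_lower. Qed.

End Metric.

(** * Additivity of the intrinsic operators *)

Section Operators.
Context {R : realType} {n : nat}.
Variables (U : set 'rV[R]_n) (g : 'rV[R]_n -> 'M[R]_n).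
Hypothesis mg : metric_on U g.
Implicit Types (x : 'rV[R]_n) (f : 'rV[R]_n -> R)
  (w : 'I_n -> 'rV[R]_n -> R) (S A B : 'I_n -> 'I_n -> 'rV[R]_n -> R).

Let oU := metric_open U g mg.
Let sg := smooth_metric U g mg.
Let sgi := smooth_ginv U g mg.
Let sch := smooth_christoffel U g mg.

Lemma smooth_ricci i j : smooth U (ricci g i j).
Proof. by rewrite /ricci /riemann_up; smooth_tac. Qed.

Lemma smooth_scal : smooth U (scal g).
Proof. by rewrite /scal /trace; smooth_tac; exact: smooth_ricci. Qed.

Lemma smooth_schouten i j : smooth U (schouten g i j).
Proof. by rewrite /schouten; smooth_tac; first [exact: smooth_ricci | exact:
  smooth_scal]. Qed.

Lemma smooth_schoutenJ : smooth U (schoutenJ g).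
Proof. by rewrite /schoutenJ; smooth_tac; exact: smooth_scal. Qed.

(** Common core of the Laplacian and of [div_grad], both being the trace of the covariant derivative
    of a 1-form. The splitting is assumed on all of [U] because it gets differentiated. *)
Lemma trace_nabla1D w w1 w2 x : U x -> (forall i, smooth U (w1 i)) ->
  (forall i, smooth U (w2 i)) ->
  (forall y, U y -> forall i, w i y = w1 i y + w2 i y) ->
  trace g (fun i j => nabla1 g w i j) x =
  trace g (fun i j => nabla1 g w1 i j) x + trace g (fun i j => nabla1 g w2 i j)
    x.
Proof.
move=> Ux s1 s2 wE.
rewrite /trace -big_split; apply: eq_bigr => i _ /=.
rewrite -big_split; apply: eq_bigr => j _ /=; rewrite -mulrDr; congr (_ * _).
have -> : nabla1 g w i j x = pd i (fun y => w1 j y + w2 j y) x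
    - \sum_m christoffel g m i j x * (w1 m x + w2 m x).
  congr (_ - _); first by apply: (eq_pd U) => // y Uy; exact: wE.
  by apply: eq_bigr => m _; rewrite wE.
rewrite pdD; [|exact: smooth_diff (s1 j) Ux|exact: smooth_diff (s2 j) Ux].
under eq_bigr do rewrite mulrDr.
by rewrite big_split opprD /= addrACA.
Qed.

Lemma laplacianD f f1 f2 x : U x -> smooth U f1 -> smooth U f2 ->
  (forall y, U y -> f y = f1 y + f2 y) ->
  laplacian g f x = laplacian g f1 x + laplacian g f2 x.
Proof.
move=> Ux s1 s2 fE; apply: trace_nabla1D => // [i|i|y Uy i].
- exact: smooth_pd.
- exact: smooth_pd.
rewrite -pdD; [|exact: smooth_diff s1 Uy|exact: smooth_diff s2 Uy].
exact: (eq_pd U).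
Qed.

Lemma div_gradD S A B f x : U x -> (forall i j, smooth U (A i j)) ->
  (forall i j, smooth U (B i j)) -> smooth U f ->
  (forall y, U y -> forall i j, S i j y = A i j y + B i j y) ->
  div_grad g S f x = div_grad g A f x + div_grad g B f x.
Proof.
move=> Ux sA sB sf SE; apply: trace_nabla1D => // [i|i|y Uy i].
- by smooth_tac.
- by smooth_tac.
rewrite -big_split; apply: eq_bigr => p _ /=; rewrite -big_split.
by apply: eq_bigr => q _ /=; rewrite SE // !mulrDl.
Qed.

Lemma inner2C S A x : U x -> inner2 g S A x = inner2 g A S x.
Proof.
move=> Ux; rewrite /inner2.
transitivity (\sum_i \sum_k \sum_j \sum_l
    ginv g i k x * ginv g j l x * S i j x * A k l x).
  by apply: eq_bigr => i _; rewrite exchange_big.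
rewrite exchange_big; apply: eq_bigr => k _ /=.
rewrite [RHS]exchange_big; apply: eq_bigr => i _ /=.
rewrite exchange_big; apply: eq_bigr => l _ /=; apply: eq_bigr => j _.
rewrite (ginvC U g mg x i k Ux) (ginvC U g mg x j l Ux).
by move: (ginv g) => gi; ring.
Qed.

(** The cross term has [B] first, to match the order of [fialkow] and the intrinsic Schouten tensor
    in [tildeQ4]. *)
Lemma inner2_sqD S A B x : U x -> (forall i j, S i j x = A i j x + B i j x) ->
  inner2 g S S x = inner2 g A A x + 2 * inner2 g B A x + inner2 g B B x.
Proof.
move=> Ux SE.
have -> : inner2 g S S x =
    inner2 g A A x + inner2 g A B x + inner2 g B A x + inner2 g B B x.
  rewrite /inner2 -!big_split; apply: eq_bigr => i _ /=.
  rewrite -!big_split; apply: eq_bigr => j _ /=.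
  rewrite -!big_split; apply: eq_bigr => k _ /=.
  rewrite -!big_split; apply: eq_bigr => l _ /=.
  rewrite !SE; move: (ginv g) (A i j x) (B i j x) (A k l x) (B k l x) => gi *.
  by ring.
rewrite (inner2C A B) //; move: (inner2 g _ _ x) (inner2 g _ _ x) => *; ring.
Qed.

End Operators.

(** * Multilinear algebra *)

(** The Kulkarni-Nomizu product evaluated on four vectors splits into products of pairings. The
    swaps bring every product to one fourfold sum in the order [i j l m], where the summands
    agree. *)
Lemma kulkarni_nomizu_sum {R : comNzRingType} {n : nat}
    (r : 'I_n -> 'I_n -> 'I_n -> 'I_n -> R) (P g : 'I_n -> 'I_n -> R)
    (x y z w : 'I_n -> R) :
  \sum_i \sum_j \sum_l \sum_m (r i j l m - (P i l * g j m - P j l * g i m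
    - P i m * g j l + P j m * g i l)) * x i * y j * z l * w m =
  \sum_i \sum_j \sum_l \sum_m r i j l m * x i * y j * z l * w m
  - ((\sum_i \sum_l P i l * x i * z l) * (\sum_j \sum_m g j m * y j * w m)
     - (\sum_j \sum_l P j l * y j * z l) * (\sum_i \sum_m g i m * x i * w m)
     - (\sum_i \sum_m P i m * x i * w m) * (\sum_j \sum_l g j l * y j * z l)
     + (\sum_j \sum_m P j m * y j * w m) * (\sum_i \sum_l g i l * x i * z l)).
Proof.
have prod (A B : 'I_n -> 'I_n -> R) : (\sum_i \sum_l A i l) * (\sum_j \sum_m B
  j m) =
    \sum_i \sum_j \sum_l \sum_m A i l * B j m.
  rewrite big_distrl; apply: eq_bigr => i _; rewrite big_distrr; apply: eq_bigr
    => j _.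
  rewrite big_distrl; apply: eq_bigr => l _; rewrite big_distrr.
  by apply: eq_bigr => m _.
have swap (E : 'I_n -> 'I_n -> 'I_n -> 'I_n -> R) :
    \sum_i \sum_j \sum_l \sum_m E i j l m = \sum_j \sum_i \sum_l \sum_m E i j l
      m.
  by rewrite exchange_big.
have swap2 (E : 'I_n -> 'I_n -> 'I_n -> 'I_n -> R) :
    \sum_i \sum_j \sum_l \sum_m E i j l m = \sum_i \sum_j \sum_m \sum_l E i j l
      m.
  by apply: eq_bigr => i _; apply: eq_bigr => j _; rewrite exchange_big.
rewrite !prod.
rewrite [\sum_i \sum_j \sum_l \sum_m P i l * y i * z l * _]swap.
rewrite [\sum_i \sum_j \sum_l \sum_m P i l * x i * w l * _]swap2.
rewrite [\sum_i \sum_j \sum_l \sum_m P i l * y i * w l * _]swap.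
rewrite [\sum_j \sum_i \sum_l \sum_m P i l * y i * w l * _]swap2.
rewrite -!sumrB -big_split -sumrB; apply: eq_bigr => i _ /=.
rewrite -!sumrB -big_split -sumrB; apply: eq_bigr => j _ /=.
rewrite -!sumrB -big_split -sumrB; apply: eq_bigr => l _ /=.
rewrite -!sumrB -big_split -sumrB; apply: eq_bigr => m _ /=.
by ring.
Qed.

(** The connection terms are moved from [l] to [hi] by renaming indices; the factor of [l c d] on
    the right is then the derivative of the inverse metric given by [pd_ginv]. *)
Lemma trace_covariant_derivative {R : comNzRingType} {k : nat}
    (hi l dl : 'I_k -> 'I_k -> R) (C : 'I_k -> 'I_k -> R) :
  \sum_c \sum_d hi c d * (dl c d - \sum_e C e c * l e d - \sum_e C e d * l c e)
    =
  \sum_c \sum_d ((- (\sum_m C c m * hi m d) - \sum_m C d m * hi c m) * l c d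
    + hi c d * dl c d).
Proof.
have E1 : \sum_c \sum_d hi c d * (\sum_e C e c * l e d) =
    \sum_c \sum_d (\sum_m C c m * hi m d) * l c d.
  under eq_bigr do under eq_bigr do rewrite big_distrr /=.
  under eq_bigr do rewrite exchange_big /=.
  rewrite exchange_big; apply: eq_bigr => c _ /=.
  rewrite exchange_big; apply: eq_bigr => d _ /=.
  by rewrite big_distrl; apply: eq_bigr => e _ /=; ring.
have E2 : \sum_c \sum_d hi c d * (\sum_e C e d * l c e) =
    \sum_c \sum_d (\sum_m C d m * hi c m) * l c d.
  apply: eq_bigr => c _; under eq_bigr do rewrite big_distrr /=.
  rewrite exchange_big; apply: eq_bigr => d _ /=.
  by rewrite big_distrl; apply: eq_bigr => e _ /=; ring.
under eq_bigr do under eq_bigr do rewrite !mulrBr.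
under [RHS]eq_bigr do under eq_bigr do rewrite mulrDl !mulNr.
under eq_bigr do rewrite !sumrB.
under [RHS]eq_bigr do rewrite big_split sumrB sumrN /=.
by rewrite !sumrB big_split sumrB sumrN /= E1 E2; ring.
Qed.

Section BilinearForm.
Context {R : comNzRingType} {n : nat} (G : 'M[R]_n).

Definition ip (v w : 'rV[R]_n) : R := (v *m G *m w^T) 0 0.

Lemma ipE v w : ip v w = \sum_i \sum_j G i j * v 0 i * w 0 j.
Proof.
rewrite /ip mxE exchange_big /=; apply: eq_bigr => j _.
rewrite !mxE big_distrl /=; apply: eq_bigr => i _.
by rewrite [v _ _ * _]mulrC.
Qed.

Lemma ipDl v1 v2 w : ip (v1 + v2) w = ip v1 w + ip v2 w.
Proof. by rewrite /ip !mulmxDl mxE. Qed.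

Lemma ipNl v w : ip (- v) w = - ip v w.
Proof. by rewrite /ip !mulNmx mxE. Qed.

Lemma ipZl c v w : ip (c *: v) w = c * ip v w.
Proof. by rewrite /ip -!scalemxAl mxE. Qed.

Lemma ip0l w : ip 0 w = 0.
Proof. by rewrite /ip !mul0mx mxE. Qed.

Lemma ip_suml (I : Type) (r : seq I) (P : pred I) v w :
  ip (\sum_(i <- r | P i) v i) w = \sum_(i <- r | P i) ip (v i) w.
Proof. by apply: (big_morph (ip^~ w)) => [v1 v2|]; rewrite ?ipDl ?ip0l. Qed.

Hypothesis GT : G^T = G.

Lemma ipC v w : ip v w = ip w v.
Proof.
rewrite /ip.
have <- : (v *m G *m w^T)^T = w *m G *m v^T by rewrite !trmx_mul trmxK GT
  mulmxA.
by rewrite [RHS]mxE.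
Qed.

Lemma ipDr w v1 v2 : ip w (v1 + v2) = ip w v1 + ip w v2.
Proof. by rewrite ipC ipDl !(ipC w). Qed.

Lemma ipNr w v : ip w (- v) = - ip w v.
Proof. by rewrite ipC ipNl (ipC w). Qed.

Lemma ipZr c w v : ip w (c *: v) = c * ip w v.
Proof. by rewrite ipC ipZl (ipC w). Qed.

Lemma ip_sumr (I : Type) (r : seq I) (P : pred I) v w :
  ip w (\sum_(i <- r | P i) v i) = \sum_(i <- r | P i) ip w (v i).
Proof. by rewrite ipC ip_suml; apply: eq_bigr => i _; exact: ipC. Qed.

End BilinearForm.

(* With [Gam] the Christoffel symbols, [dGam] their partial derivatives and
   [S] the common second derivative of the map, the left-hand side is the
   curvature of the connection pulled back along the map. *)
Lemma pullback_curvature_identity {R : comNzRingType} {n : nat}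
    (Gam : 'I_n -> 'I_n -> 'I_n -> R) (dGam : 'I_n -> 'I_n -> 'I_n -> 'I_n -> R)
    (X Y S : 'I_n -> R) (i l : 'I_n) :
  \sum_j ((\sum_m dGam m i j l * X m) * Y j + Gam i j l * S j)
  - \sum_j ((\sum_m dGam m i j l * Y m) * X j + Gam i j l * S j)
  + \sum_m ((\sum_j Gam i j m * X j) * (\sum_j Gam m j l * Y j)
            - (\sum_j Gam i j m * Y j) * (\sum_j Gam m j l * X j)) =
  \sum_p \sum_q (dGam p i q l - dGam q i p l
    + \sum_m (Gam i p m * Gam m q l - Gam i q m * Gam m p l)) * X p * Y q.
Proof.
have E1 (Z W : 'I_n -> R) : \sum_j ((\sum_m dGam m i j l * Z m) * W j + Gam i j
  l * S j)
    = \sum_p \sum_q dGam p i q l * Z p * W q + \sum_j Gam i j l * S j.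
  rewrite big_split /=; congr (_ + _).
  under eq_bigr do rewrite big_distrl /=.
  by rewrite exchange_big.
have E2 (Z W : 'I_n -> R) : \sum_m (\sum_j Gam i j m * Z j) * (\sum_j Gam m j l
  * W j)
    = \sum_p \sum_q (\sum_m Gam i p m * Gam m q l) * Z p * W q.
  under eq_bigr do rewrite big_distrl /=.
  rewrite exchange_big /=; apply: eq_bigr => p _.
  under eq_bigr do rewrite big_distrr /=.
  rewrite exchange_big /=; apply: eq_bigr => q _.
  rewrite -mulrA big_distrl /=; apply: eq_bigr => m _; ring.
have E3 (f : 'I_n -> 'I_n -> R) : \sum_p \sum_q f q p * Y p * X q =
    \sum_p \sum_q f p q * X p * Y q.
  rewrite exchange_big /=; apply: eq_bigr => p _; apply: eq_bigr => q _; ring.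
rewrite (E1 X Y) (E1 Y X) sumrB (E2 X Y) (E2 Y X).
rewrite (E3 (fun q p => dGam p i q l)) (E3 (fun q p => \sum_m Gam i p m * Gam m
  q l)).
have alg (a b s c d : R) : a + s - (b + s) + (c - d) = (a - b) + (c - d) by
  ring.
rewrite alg -!sumrB -big_split; apply: eq_bigr => p _ /=.
rewrite -!sumrB -big_split; apply: eq_bigr => q _ /=.
by rewrite sumrB; ring.
Qed.

(** * Vector fields along an immersion *)

Section Fields.
Context {R : realType} {n k : nat}.
Variables (V : set 'rV[R]_n) (g : 'rV[R]_n -> 'M[R]_n) (mg : metric_on V g).
Variables (U : set 'rV[R]_k) (F : 'rV[R]_k -> 'rV[R]_n).
Hypotheses (oU : open U) (sF : smooth_map U F) (FV : forall u, U u -> V (F u)).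
Implicit Types (X Y : 'I_n -> 'rV[R]_k -> R).

Local Notation T := (tangent F).
Local Notation nabla := (nabla_along g F).
Local Notation G u := (g (F u)).

(** Freezing a field at a point as a row vector lets the bilinearity of [ip] replace manipulations
    of component sums. *)
Definition vec X (u : 'rV[R]_k) : 'rV[R]_n := \row_i X i u.

Definition smooth_field X := forall i, smooth U (X i).

Lemma innerE X Y u : inner g F X Y u = ip (G u) (vec X u) (vec Y u).
Proof.
rewrite ipE; apply: eq_bigr => i _; apply: eq_bigr => j _.
by rewrite !mxE.
Qed.

Lemma vec_tangent al u : vec (T al) u = row al ('J F u).
Proof. by apply/rowP => i; rewrite !mxE. Qed.

Lemma pullback_ip al be u :
  pullback g F u al be = ip (G u) (vec (T al) u) (vec (T be) u).
Proof.
rewrite !vec_tangent /ip /pullback !rowE trmx_mul !mulmxA.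
set A := 'J F u *m g (F u) *m ('J F u)^T.
have -> : delta_mx 0 al *m 'J F u *m g (F u) *m ('J F u)^T *m (delta_mx 0 be)^T
   = row al A *m (delta_mx 0 be)^T by rewrite rowE !mulmxA.
by rewrite trmx_delta -colE !mxE.
Qed.

Lemma tangentE al i u : U u -> T al i u = pd al (fun y => F y 0 i) u.
Proof.
move=> Uu; apply: jacobianE => j; exact: smooth_diff (sF j) Uu.
Qed.

Lemma smooth_tangent al : smooth_field (T al).
Proof.
move=> i; apply: eq_smooth oU _ (smooth_pd U _ al (sF i)) => u Uu.
by rewrite tangentE.
Qed.

Lemma pd_tangentC al be i u : U u -> pd al (T be i) u = pd be (T al i) u.
Proof.
move=> Uu.
have E a b : pd a (T b i) u = pd a (pd b (fun y => F y 0 i)) u.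
  by apply: (eq_pd U) => // v Uv; rewrite tangentE.
by rewrite (E al be) (E be al); apply: (pdC U).
Qed.

Lemma smooth_pull f : smooth V f -> smooth U (fun u => f (F u)).
Proof. exact: smooth_comp. Qed.

Lemma pd_pull f al u : smooth V f -> U u ->
  pd al (fun u => f (F u)) u = \sum_m pd m f (F u) * T al m u.
Proof.
move=> sf Uu; have [] // := pd_comp F f u al.
- by move=> i; exact: smooth_diff (sF i) Uu.
- exact: smooth_diff sf (FV u Uu).
Qed.

(** The connection matrix of the ambient tangent bundle pulled back along [F]. *)
Definition conn (al : 'I_k) (i l : 'I_n) : 'rV[R]_k -> R :=
  fun u => \sum_j christoffel g i j l (F u) * T al j u.

Lemma nablaE al X i u : nabla al X i u = pd al (X i) u + \sum_l conn al i l u *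
  X l u.
Proof.
rewrite /nabla_along exchange_big /=; congr (_ + _); apply: eq_bigr => l _.
by rewrite /conn big_distrl.
Qed.

Let sgF i j : smooth U (fun u => g (F u) i j).
Proof. exact: (smooth_pull _ (smooth_metric V g mg i j)). Qed.

Let sT := smooth_tangent.

Lemma smooth_conn al i l : smooth U (conn al i l).
Proof.
rewrite /conn; smooth_tac; first exact: smooth_pull (smooth_christoffel V g mg
  _ _ _).
exact: sT.
Qed.

Lemma smooth_nabla al X : smooth_field X -> smooth_field (nabla al X).
Proof.
move=> sX i; apply: (eq_smooth U (fun u => pd al (X i) u + \sum_l conn al i l u
  * X l u)).
- exact: oU.
- by move=> u _; rewrite nablaE.
- by smooth_tac; first [exact: sX | exact: smooth_conn].
Qed.

Lemma smooth_inner X Y : smooth_field X -> smooth_field Y -> smooth U (inner g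
  F X Y).
Proof. by move=> sX sY; rewrite /inner /eval2; smooth_tac; first [exact: sX |
  exact: sY]. Qed.

Lemma eq_nabla al X Y : (forall u, U u -> forall i, X i u = Y i u) ->
  forall u, U u -> vec (nabla al X) u = vec (nabla al Y) u.
Proof.
move=> XY u Uu; apply/rowP => i; rewrite !mxE !nablaE; congr (_ + _).
  by apply: (eq_pd U) => // v Uv; exact: XY.
by apply: eq_bigr => l _; rewrite XY.
Qed.

Lemma nablaD al X Y u : U u -> smooth_field X -> smooth_field Y ->
  vec (nabla al (fun i v => X i v + Y i v)) u =
  vec (nabla al X) u + vec (nabla al Y) u.
Proof.
move=> Uu sX sY; apply/rowP => i; rewrite !mxE !nablaE.
rewrite pdD; [|exact: smooth_diff (sX i) Uu|exact: smooth_diff (sY i) Uu].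
under eq_bigr do rewrite mulrDr.
by rewrite big_split /= addrACA.
Qed.

Lemma nablaZ al (c : 'rV[R]_k -> R) X u : U u -> smooth U c -> smooth_field X ->
  vec (nabla al (fun i v => c v * X i v)) u =
  pd al c u *: vec X u + c u *: vec (nabla al X) u.
Proof.
move=> Uu sc sX; apply/rowP => i; rewrite !mxE !nablaE.
rewrite pdM; [|exact: smooth_diff sc Uu|exact: smooth_diff (sX i) Uu].
under eq_bigr do rewrite mulrCA.
by rewrite -big_distrr /= mulrDr addrA.
Qed.

Lemma nabla_sum al (I : Type) (r : seq I) (X : I -> 'I_n -> 'rV[R]_k -> R) u :
  U u -> (forall m, smooth_field (X m)) ->
  vec (nabla al (fun i v => \sum_(m <- r) X m i v)) u =
  \sum_(m <- r) vec (nabla al (X m)) u.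
Proof.
move=> Uu sX; apply/rowP => i; rewrite summxE mxE nablaE.
rewrite pd_sum; last by move=> m; exact: smooth_diff (sX m i) Uu.
under [X in _ + X = _]eq_bigr do rewrite big_distrr /=.
rewrite [X in _ + X = _]exchange_big -big_split; apply: eq_bigr => m _ /=.
by rewrite mxE nablaE.
Qed.

(** Vanishing torsion: second derivatives of [F] commute and the Christoffel symbols are
    symmetric. *)
Lemma nabla_tangentC al be u : U u ->
  vec (nabla al (T be)) u = vec (nabla be (T al)) u.
Proof.
move=> Uu; apply/rowP => i; rewrite !mxE !nablaE pd_tangentC //; congr (_ + _).
rewrite /conn; under eq_bigr do rewrite big_distrl /=.
rewrite exchange_big; apply: eq_bigr => j _ /=.
rewrite big_distrl; apply: eq_bigr => l _ /=.
rewrite (christoffelC V g mg) //; last exact: FV.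
by move: (christoffel g) => Ga; ring.
Qed.

(** Metric compatibility of the pulled-back connection. *)
Lemma pd_inner al X Y u : U u -> smooth_field X -> smooth_field Y ->
  pd al (inner g F X Y) u =
  ip (G u) (vec (nabla al X) u) (vec Y u) + ip (G u) (vec X u) (vec (nabla al
    Y) u).
Proof.
move=> Uu sX sY.
have dif (f : 'rV[R]_k -> R) (sf : smooth U f) : differentiable f u.
  exact: smooth_diff sf Uu.
pose b i l := \sum_j christoffel1 g i j l (F u) * T al j u.
have bE i l : \sum_m g (F u) i m * conn al m l u = b i l.
  rewrite /conn; under eq_bigr do rewrite big_distrr /=.
  rewrite exchange_big; apply: eq_bigr => j _ /=.
  rewrite -(lower_christoffel V g mg (F u) i j l (FV u Uu)) big_distrl.
  by apply: eq_bigr => m _; rewrite mulrA.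
have dg i j : pd al (fun v => g (F v) i j) u = b i j + b j i.
  rewrite (pd_pull (fun x => g x i j) al u (smooth_metric V g mg i j) Uu).
  rewrite -big_split; apply: eq_bigr => m _ /=.
  by rewrite (pd_metric V g mg) ?mulrDl //; exact: FV.
have gC i j : g (F u) i j = g (F u) j i by apply: (metricC V g mg); exact: FV.
have sgX i j : smooth U (fun v => g (F v) i j * X i v) by smooth_tac; exact: sX.
have dE : pd al (inner g F X Y) u = \sum_i \sum_j
   (((b i j + b j i) * X i u + g (F u) i j * pd al (X i) u) * Y j u
    + g (F u) i j * X i u * pd al (Y j) u).
  rewrite /inner /eval2 pd_sum; last first.
    by move=> i; apply: dif; smooth_tac; exact: sY.
  apply: eq_bigr => i _; rewrite pd_sum; last first.
    by move=> j; apply: dif; smooth_tac; exact: sY.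
  apply: eq_bigr => j _; rewrite pdM; [|exact: dif|exact: dif (sY j)].
  by rewrite pdM; [rewrite dg|exact: dif|exact: dif (sX i)].
have nE (Z W : 'I_n -> 'rV[R]_k -> R) : ip (G u) (vec (nabla al Z) u) (vec W u)
  =
    \sum_i \sum_j (g (F u) i j * pd al (Z i) u * W j u + b j i * Z i u * W j u).
  rewrite ipE; transitivity (\sum_i \sum_j g (F u) i j * pd al (Z i) u * W j u
     + \sum_i \sum_j b j i * Z i u * W j u).
    transitivity (\sum_i \sum_j (g (F u) i j * pd al (Z i) u * W j u +
       g (F u) i j * (\sum_l conn al i l u * Z l u) * W j u)).
      apply: eq_bigr => i _; apply: eq_bigr => j _.
      by rewrite !mxE nablaE mulrDr mulrDl.
    under eq_bigr do rewrite big_split /=.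
    rewrite big_split /=; congr (_ + _).
    rewrite exchange_big [RHS]exchange_big /=; apply: eq_bigr => j _.
    rewrite -big_distrl -[RHS]big_distrl /=; congr (_ * _).
    under eq_bigr do rewrite big_distrr /=.
    rewrite exchange_big; apply: eq_bigr => l _ /=.
    rewrite -bE big_distrl; apply: eq_bigr => i _ /=.
    by rewrite gC mulrA.
  by rewrite -big_split; apply: eq_bigr => i _ /=; rewrite -big_split.
rewrite dE (nE X Y) [ip _ (vec X u) _]ipC; last first.
  by apply/matrixP => i j; rewrite mxE gC.
rewrite (nE Y X) [X in _ + X]exchange_big -big_split; apply: eq_bigr => i _ /=.
rewrite -big_split; apply: eq_bigr => j _ /=.
rewrite (gC j i); move: (b i j) (b j i) (pd al (X i) u) (pd al (Y j) u).
by move=> *; ring.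
Qed.

(** Curvature commutes with pullback. The second derivatives of [X] agree and its first derivatives
    occur symmetrically in [ga] and [de], so only derivatives and products of connection matrices
    survive. *)
Lemma nabla_curvature ga de X i u : U u -> smooth_field X ->
  nabla ga (nabla de X) i u - nabla de (nabla ga X) i u =
  \sum_j (\sum_p \sum_q riemann_up g i j p q (F u) * T ga p u * T de q u) * X j
    u.
Proof.
move=> Uu sX.
have dif (f : 'rV[R]_k -> R) (sf : smooth U f) : differentiable f u.
  exact: smooth_diff sf Uu.
have pdconn al be l m : pd al (conn be l m) u =
    \sum_j ((\sum_s pd s (christoffel g l j m) (F u) * T al s u) * T be j u
      + christoffel g l j m (F u) * pd al (T be j) u).
  have sG j := smooth_pull _ (smooth_christoffel V g mg l j m).
  rewrite /conn pd_sum; last first.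
    by move=> j; apply: dif; smooth_tac; first [exact: sG | exact: sT].
  apply: eq_bigr => j _; rewrite pdM; [|exact: dif (sG j)|exact: dif (sT be j)].
  by rewrite pd_pull //; exact: smooth_christoffel.
have nn al be : nabla al (nabla be X) i u = pd al (pd be (X i)) u
    + \sum_l (pd al (conn be i l) u * X l u
              + conn be i l u * pd al (X l) u + conn al i l u * pd be (X l) u)
    + \sum_l (\sum_m conn al i m u * conn be m l u) * X l u.
  rewrite nablaE.
  have -> : pd al (nabla be X i) u =
      pd al (fun v => pd be (X i) v + \sum_l conn be i l v * X l v) u.
    by apply: (eq_pd U) => // v _; rewrite nablaE.
  have sc l : smooth U (fun v => conn be i l v * X l v).
    by smooth_tac; first [exact: smooth_conn | exact: sX].
  rewrite pdD; last 2 first.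
  - by apply: dif; smooth_tac; exact: sX.
  - by apply: dif; smooth_tac.
  rewrite pd_sum; last by move=> l; exact: dif.
  rewrite -!addrA; congr (_ + _).
  under [\sum_l conn al i l u * _]eq_bigr do rewrite nablaE mulrDr.
  rewrite big_split /= addrA; congr (_ + _).
    rewrite -big_split; apply: eq_bigr => l _ /=.
    by rewrite pdM; [|exact: dif (smooth_conn _ _ _)|exact: dif (sX l)].
  under eq_bigr do rewrite big_distrr /=.
  rewrite exchange_big; apply: eq_bigr => l _ /=.
  by rewrite big_distrl; apply: eq_bigr => m _; rewrite mulrA.
rewrite (nn ga de) (nn de ga) (pdC U (X i) ga de u oU (sX i) Uu).
set D := pd de _ u; set A1 := \sum_l _; set A2 := \sum_l _.
set B1 := \sum_l _; set B2 := \sum_l _.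
have -> : D + A1 + A2 - (D + B1 + B2) = (A1 - B1) + (A2 - B2) by ring.
rewrite /A1 /A2 /B1 /B2 -!sumrB -big_split; apply: eq_bigr => l _ /=.
transitivity ((pd ga (conn de i l) u - pd de (conn ga i l) u
   + \sum_m (conn ga i m u * conn de m l u - conn de i m u * conn ga m l u)) *
     X l u).
  rewrite sumrB; move: (conn) (@pd R k) => c d; ring.
congr (_ * _); rewrite !pdconn.
(* Both sums must display the same second derivative of [F], which plays the role of [S] in the
   algebraic identity. *)
under [X in _ - X + _]eq_bigr do rewrite (pd_tangentC de ga) //.
exact: (pullback_curvature_identity (fun i j l => christoffel g i j l (F u))
  (fun m i j l => pd m (christoffel g i j l) (F u)) (T ga ^~ u) (T de ^~ u)
  (fun j => pd ga (T de j) u)).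
Qed.

Lemma eval4_riemann X Y ga de u : U u -> smooth_field Y ->
  eval4 F (riemann g) X Y (T ga) (T de) u =
  ip (G u) (vec X u) (vec (nabla ga (nabla de Y)) u - vec (nabla de (nabla ga
    Y)) u).
Proof.
move=> Uu sY; rewrite ipE /eval4 /riemann; apply: eq_bigr => i _.
transitivity (\sum_m g (F u) i m * X i u * \sum_j (\sum_p \sum_q
   riemann_up g m j p q (F u) * T ga p u * T de q u) * Y j u); last first.
  by apply: eq_bigr => m _; rewrite !mxE -nabla_curvature.
under [RHS]eq_bigr do rewrite big_distrr /=.
rewrite [RHS]exchange_big; apply: eq_bigr => j _ /=.
under [RHS]eq_bigr do rewrite big_distrl big_distrr /=.
rewrite [RHS]exchange_big; apply: eq_bigr => p _ /=.
under [RHS]eq_bigr do rewrite big_distrl big_distrr /=.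
rewrite [RHS]exchange_big; apply: eq_bigr => q _ /=.
rewrite !big_distrl; apply: eq_bigr => m _ /=.
by move: (riemann_up g m j p q (F u)) => r; ring.
Qed.

(** * Immersions: the Gauss and Codazzi equations *)

Hypothesis immF : forall u, U u -> row_free ('J F u).

Local Notation h := (pullback g F).
Local Notation L := (sff g F).
Local Notation t al u := (vec (T al) u).

Lemma metric_sym_at u : U u -> (G u)^T = G u.
Proof. by case: mg => _ _ sg _ /FV /sg. Qed.

Lemma pullbackE al be u : h u al be = inner g F (T al) (T be) u.
Proof. by rewrite innerE pullback_ip. Qed.

Lemma metric_pullback : metric_on U h.
Proof.
split=> [//|al be|u Uu|u Uu v v0].
- apply: eq_smooth oU _ (smooth_inner _ _ (sT al) (sT be)) => u _.
  by rewrite pullbackE.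
- by rewrite /pullback !trmx_mul trmxK metric_sym_at // mulmxA.
case: mg => _ _ _ /(_ _ (FV u Uu)) pg.
have := pg (v *m 'J F u); rewrite trmx_mul !mulmxA /pullback; apply.
apply: contraNneq v0 => vJ; apply/eqP.
by apply: (row_free_inj (immF u Uu)); rewrite vJ mul0mx.
Qed.

Let mh := metric_pullback.
Let schh := smooth_christoffel U h mh.
Let shi := smooth_ginv U h mh.

Lemma vec_normal_part X u : vec (normal_part g F X) u = vec X u -
  \sum_al (\sum_be ginv h al be u * ip (G u) (vec X u) (t be u)) *: t al u.
Proof.
apply/rowP => i; rewrite !mxE summxE; congr (_ - _).
apply: eq_bigr => al _; rewrite !mxE big_distrl; apply: eq_bigr => be _ /=.
by rewrite innerE.
Qed.

Lemma ip_normal_part X be u : U u ->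
  ip (G u) (vec (normal_part g F X) u) (t be u) = 0.
Proof.
move=> Uu; rewrite vec_normal_part ipDl ipNl ip_suml; apply/eqP.
rewrite subr_eq0; apply/eqP.
rewrite -(lower_raise U h mh u (fun ga => ip (G u) (vec X u) (t ga u)) be Uu).
apply: eq_bigr => al _; rewrite ipZl -pullback_ip mulrC.
by rewrite (metricC U h mh).
Qed.

Lemma ip_tangent_normal_part X be u : U u ->
  ip (G u) (t be u) (vec (normal_part g F X) u) = 0.
Proof.
by move=> Uu; rewrite ipC ?ip_normal_part //; exact: metric_sym_at.
Qed.

(** Koszul's argument: [K] is symmetric in its first two indices, and each derivative of [h] is a
    sum of two values of [K]; cyclic permutation solves for [K]. *)
Lemma ip_nabla_tangent al be ga u : U u ->
  ip (G u) (vec (nabla al (T be)) u) (t ga u) = christoffel1 h ga al be u.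
Proof.
move=> Uu; pose K a b c := ip (G u) (vec (nabla a (T b)) u) (t c u).
have KC a b c : K a b c = K b a c by rewrite /K nabla_tangentC.
have dh a b c : pd a (fun v => h v b c) u = K a b c + K a c b.
  have -> : pd a (fun v => h v b c) u = pd a (inner g F (T b) (T c)) u.
    by apply: (eq_pd U) => // v _; rewrite pullbackE.
  rewrite pd_inner // /K; congr (_ + _); rewrite ipC //; exact: metric_sym_at.
rewrite -/(K al be ga) /christoffel1 !dh (KC be ga al) (KC be al ga) (KC al ga
  be).
by field.
Qed.

Lemma gauss_formula al be u : U u ->
  vec (nabla al (T be)) u = \sum_ga christoffel h ga al be u *: t ga u
    + vec (L al be) u.
Proof.
move=> Uu; rewrite /sff vec_normal_part.
suff E ga : \sum_c ginv h ga c u * ip (G u) (vec (nabla al (T be)) u) (t c u) =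
    christoffel h ga al be u.
  by under [X in _ = _ + (_ - X)]eq_bigr do rewrite E; rewrite addrC subrK.
rewrite (christoffelE h u) //; apply: eq_bigr => c _.
by rewrite ip_nabla_tangent.
Qed.

Lemma smooth_normal_part X : smooth_field X -> smooth_field (normal_part g F X).
Proof.
move=> sX i; rewrite /normal_part; smooth_tac; first [exact: sX | exact: shi |
  idtac].
- exact: smooth_inner.
- exact: sT.
Qed.

Lemma smooth_sff al be : smooth_field (L al be).
Proof. by apply: smooth_normal_part; apply: smooth_nabla; exact: sT. Qed.

Lemma sffC al be u : U u -> vec (L al be) u = vec (L be al) u.
Proof. by move=> Uu; rewrite /sff !vec_normal_part nabla_tangentC. Qed.

Lemma nabla2_tangent ga de be u : U u ->
  vec (nabla ga (nabla de (T be))) u =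
  \sum_m (pd ga (christoffel h m de be) u *: t m u + christoffel h m de be u *:
    (\sum_p christoffel h p ga m u *: t p u + vec (L ga m) u))
  + vec (nabla ga (L de be)) u.
Proof.
move=> Uu.
have sY m : smooth_field (fun i v => christoffel h m de be v * T m i v).
  by move=> i; smooth_tac; first [exact: schh | exact: sT].
have sZ : smooth_field (fun i v => \sum_m christoffel h m de be v * T m i v).
  by move=> i; smooth_tac; first [exact: schh | exact: sT].
(* The Gauss formula holds on all of [U], hence may be differentiated. *)
rewrite (eq_nabla ga _ (fun i v => \sum_m christoffel h m de be v * T m i v
   + L de be i v)) //; last first.
  move=> v Uv i; have /rowP /(_ i) := gauss_formula de be v Uv.
  rewrite !mxE summxE => ->; congr (_ + _).
  by apply: eq_bigr => m _; rewrite !mxE.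
rewrite nablaD //; last exact: smooth_sff.
rewrite nabla_sum //; congr (_ + _); apply: eq_bigr => m _.
rewrite (nablaZ ga (christoffel h m de be) (T m) u Uu (schh _ _ _) (sT _)).
by rewrite gauss_formula.
Qed.

(** Weingarten's relation, obtained by differentiating the vanishing product of [X] with a tangent
    field. *)
Lemma ip_tangent_nabla_normal al ga X u : U u -> smooth_field X ->
  (forall v, U v -> forall be, ip (G v) (t be v) (vec X v) = 0) ->
  ip (G u) (t al u) (vec (nabla ga X) u) = - ip (G u) (vec (L ga al) u) (vec X
    u).
Proof.
move=> Uu sX nX; apply/eqP; rewrite -subr_eq0 opprK addrC; apply/eqP.
have -> : ip (G u) (vec (L ga al) u) (vec X u) = ip (G u) (vec (nabla ga (T
  al)) u) (vec X u).
  rewrite gauss_formula // ipDl ip_suml big1 ?add0r // => m _.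
  by rewrite ipZl nX // mulr0.
rewrite -pd_inner // -(pd_cst 0 ga u).
by apply: (eq_pd U) => // v Uv; rewrite innerE nX.
Qed.

Lemma gauss_equation al be ga de u : U u ->
  riemann h al be ga de u = eval4 F (riemann g) (T al) (T be) (T ga) (T de) u
  + ip (G u) (vec (L ga al) u) (vec (L de be) u)
  - ip (G u) (vec (L de al) u) (vec (L ga be) u).
Proof.
move=> Uu; have gT := metric_sym_at u Uu.
rewrite eval4_riemann //.
(* The terms with [christoffel h] will antisymmetrize to the intrinsic curvature, while the
   derivative of [L] contributes through Weingarten's relation. *)
have E c d : ip (G u) (t al u) (vec (nabla c (nabla d (T be))) u) =
   \sum_m h u al m * (pd c (christoffel h m d be) u
     + \sum_p christoffel h m c p u * christoffel h p d be u)
   - ip (G u) (vec (L c al) u) (vec (L d be) u).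
  rewrite nabla2_tangent // ipDr // ip_sumr //; congr (_ + _); last first.
    apply: ip_tangent_nabla_normal => //; first exact: smooth_sff.
    by move=> v Uv b; exact: ip_tangent_normal_part.
  under eq_bigr => m _.
    rewrite ipDr // !ipZr // ipDr // ip_tangent_normal_part // addr0 ip_sumr //.
    rewrite -pullback_ip.
    under eq_bigr do rewrite ipZr // -pullback_ip.
    over.
  under [RHS]eq_bigr do rewrite mulrDr.
  rewrite !big_split /=; congr (_ + _).
    by apply: eq_bigr => m _; rewrite mulrC.
  under eq_bigr do rewrite big_distrr /=.
  rewrite exchange_big; apply: eq_bigr => m _ /=.
  rewrite big_distrr; apply: eq_bigr => p _ /=.
  by move: (christoffel h) => Ga; ring.
rewrite ipDr // ipNr // (E ga de) (E de ga) /riemann /riemann_up.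
set A := ip _ _ _; set B := ip _ _ _.
have alg (p q a b : R) : p - a - (q - b) + a - b = p - q by ring.
rewrite alg -sumrB; apply: eq_bigr => m _; rewrite sumrB.
by move: (christoffel h) (@pd R k) => Ga D; ring.
Qed.

Lemma codazzi_equation X be ga de u : U u ->
  (forall m, ip (G u) (vec X u) (t m u) = 0) ->
  eval4 F (riemann g) X (T be) (T ga) (T de) u =
  (\sum_m christoffel h m de be u * ip (G u) (vec X u) (vec (L ga m) u)
   + ip (G u) (vec X u) (vec (nabla ga (L de be)) u))
  - (\sum_m christoffel h m ga be u * ip (G u) (vec X u) (vec (L de m) u)
   + ip (G u) (vec X u) (vec (nabla de (L ga be)) u)).
Proof.
move=> Uu nX; have gT := metric_sym_at u Uu.
rewrite eval4_riemann //.
have E c d : ip (G u) (vec X u) (vec (nabla c (nabla d (T be))) u) =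
   \sum_m christoffel h m d be u * ip (G u) (vec X u) (vec (L c m) u)
   + ip (G u) (vec X u) (vec (nabla c (L d be)) u).
  rewrite nabla2_tangent // ipDr // ip_sumr //; congr (_ + _).
  apply: eq_bigr => m _; rewrite ipDr // !ipZr // nX mulr0 add0r ipDr //
    ip_sumr //.
  rewrite big1 ?add0r // => p _; by rewrite ipZr // nX mulr0.
by rewrite ipDr // ipNr // (E ga de) (E de ga).
Qed.

Lemma eval4_weyl X Y Z W u : U u -> eval4 F (weyl g) X Y Z W u =
  eval4 F (riemann g) X Y Z W u
  - (eval2 F (schouten g) X Z u * ip (G u) (vec Y u) (vec W u)
     - eval2 F (schouten g) Y Z u * ip (G u) (vec X u) (vec W u)
     - eval2 F (schouten g) X W u * ip (G u) (vec Y u) (vec Z u)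
     + eval2 F (schouten g) Y W u * ip (G u) (vec X u) (vec Z u)).
Proof.
move=> Uu; rewrite -!innerE /inner /eval4 /weyl.
exact: (kulkarni_nomizu_sum (fun i j l m => riemann g i j l m (F u))
  (fun i j => schouten g i j (F u)) (fun i j => g (F u) i j)
  (X^~ u) (Y^~ u) (Z^~ u) (W^~ u)).
Qed.

Lemma eval4_riemannNN X Y Z W u : U u ->
  eval4 F (riemann g) X Y Z W u = eval4 F (riemann g) Y X W Z u.
Proof.
move=> Uu; rewrite /eval4 exchange_big; apply: eq_bigr => j _.
apply: eq_bigr => i _; rewrite exchange_big; apply: eq_bigr => m _.
apply: eq_bigr => l _.
rewrite (riemannNN V g mg (F u) i j l m (FV u Uu)).
by move: (riemann g j i m l (F u)) => r; ring.
Qed.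

Lemma eval4_riemann_pairC X Y Z W u : U u ->
  eval4 F (riemann g) X Y Z W u = - eval4 F (riemann g) Z W Y X u.
Proof.
move=> Uu; rewrite /eval4.
transitivity (\sum_l \sum_m \sum_i \sum_j
    riemann g i j l m (F u) * X i u * Y j u * Z l u * W m u).
  under eq_bigr do rewrite exchange_big.
  under eq_bigr do under eq_bigr do rewrite exchange_big.
  rewrite exchange_big /=; apply: eq_bigr => l _.
  rewrite exchange_big /=; apply: eq_bigr => m _ //.
rewrite -sumrN; apply: eq_bigr => l _; rewrite -sumrN; apply: eq_bigr => m _.
rewrite exchange_big -sumrN; apply: eq_bigr => j _ /=.
rewrite -sumrN; apply: eq_bigr => i _.
rewrite (riemann_pairCN V g mg (F u) i j l m (FV u Uu)).
by move: (riemann g l m j i (F u)) => r; ring.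
Qed.

(** * Traces of the Gauss and Codazzi equations at a point *)

Section Trace.
Variables (u : 'rV[R]_k) (Uu : U u).
Local Notation hu i j := (h u i j).

(** [trace h] frozen at [u]: the entries are numbers, so identities known only at [u] can be used
    under the sum. *)
Definition tr (f : 'I_k -> 'I_k -> R) : R := \sum_i \sum_j ginv h i j u * f i j.

Lemma eq_tr f f' : (forall i j, f i j = f' i j) -> tr f = tr f'.
Proof. by move=> E; apply: eq_bigr => i _; apply: eq_bigr => j _; rewrite E.
  Qed.

Lemma trD f f' : tr (fun i j => f i j + f' i j) = tr f + tr f'.
Proof.
rewrite -big_split; apply: eq_bigr => i _ /=; rewrite -big_split.
by apply: eq_bigr => j _; rewrite mulrDr.
Qed.

Lemma trN f : tr (fun i j => - f i j) = - tr f.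
Proof.
rewrite -sumrN; apply: eq_bigr => i _; rewrite -sumrN.
by apply: eq_bigr => j _; rewrite mulrN.
Qed.

Lemma trZ c f : tr (fun i j => c * f i j) = c * tr f.
Proof.
rewrite /tr big_distrr; apply: eq_bigr => i _; rewrite big_distrr.
by apply: eq_bigr => j _; rewrite mulrCA.
Qed.

Lemma trC f : tr (fun i j => f j i) = tr f.
Proof.
rewrite /tr exchange_big; apply: eq_bigr => i _; apply: eq_bigr => j _.
by rewrite (ginvC U h mh).
Qed.

Lemma tr_metricl i f : tr (fun c d => hu i c * f d) = f i.
Proof.
rewrite -[RHS](lower_raise U h mh u f i Uu); apply: eq_bigr => c _.
by rewrite big_distrr; apply: eq_bigr => d _; rewrite mulrCA.
Qed.

Lemma tr_metricr i f : tr (fun c d => f c * hu i d) = f i.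
Proof. by rewrite -trC -[RHS](tr_metricl i f); apply: eq_tr => c d; exact:
  mulrC. Qed.

Lemma tr_metric : tr (fun c d => hu c d) = k%:R.
Proof.
transitivity (\sum_(i < k) (1 : R)); last by rewrite sumr_const card_ord.
apply: eq_bigr => i _; have := ginv_metric U h mh u i i Uu.
rewrite eqxx => E; rewrite -[RHS]/(true%:R) -E; apply: eq_bigr => j _.
by rewrite (metricC U h mh u i j).
Qed.

Local Notation Lu a b := (vec (L a b) u).
Local Notation Hu := (vec (meanH g F) u).
Local Notation H2 := (ip (G u) Hu Hu).
Local Notation ipu := (ip (G u)).
Let gT := metric_sym_at u Uu.

Lemma vec_meanH : Hu = k%:R^-1 *: \sum_a \sum_b ginv h a b u *: Lu a b.
Proof.
apply/rowP => i; rewrite !mxE summxE; congr (_ * _); apply: eq_bigr => a _.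
by rewrite summxE; apply: eq_bigr => b _; rewrite !mxE.
Qed.

Hypothesis k0 : (0 < k)%N.

Let k0' : k%:R != 0 :> R. Proof. by rewrite pnatr_eq0 -lt0n. Qed.

Lemma tr_sff w : tr (fun a b => ipu w (Lu a b)) = k%:R * ipu w Hu.
Proof.
rewrite vec_meanH ipZr // mulrA mulfV // mul1r ip_sumr //; apply: eq_bigr => a
  _.
by rewrite ip_sumr //; apply: eq_bigr => b _; rewrite ipZr.
Qed.

Lemma vec_sff0 a b : vec (sff0 g F a b) u = Lu a b - hu a b *: Hu.
Proof.
apply/rowP => i; rewrite [LHS]mxE /sff0; move: (h u a b) => c.
by rewrite !mxE mulrC.
Qed.

Lemma sff0_sqE i j : sff0_sq g F i j u =
  tr (fun c d => ipu (Lu i c) (Lu j d)) - 2 * ipu Hu (Lu i j) + hu i j * H2.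
Proof.
have -> : sff0_sq g F i j u = tr (fun c d => ipu (Lu i c) (Lu j d)
    + - (ipu (Lu i c) Hu * hu j d) + - (hu i c * ipu Hu (Lu j d))
    + hu i c * hu j d * H2).
  apply: eq_bigr => c _; apply: eq_bigr => d _; congr (_ * _).
  rewrite innerE !vec_sff0 ipDl ipNl ipZl !ipDr // !ipNr // !ipZr //.
  by rewrite [ipu (Lu i c) Hu * _]mulrC; ring.
rewrite !trD !trN tr_metricl (tr_metricr j (fun c => ipu (Lu i c) Hu)).
have -> : tr (fun c d => hu i c * hu j d * H2) = hu i j * H2.
  rewrite (metricC U h mh u i j) // -(tr_metricl i (fun d => hu j d * H2)).
  by apply: eq_tr => c d; rewrite mulrA.
rewrite (sffC j i) // (ipC (G u) gT (Lu i j) Hu); ring.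
Qed.

Lemma eval4_riemann_tangent a b c d :
  eval4 F (riemann g) (T a) (T b) (T c) (T d) u =
  eval4 F (weyl g) (T a) (T b) (T c) (T d) u
  + (schoutenTT g F a c u * hu b d - schoutenTT g F b c u * hu a d
     - schoutenTT g F a d u * hu b c + schoutenTT g F b d u * hu a c).
Proof. by rewrite eval4_weyl // -!pullback_ip subrK. Qed.

(** The trace of Gauss contains k H.L minus the square of [L]. Expressing that square by its
    trace-free analogue turns k into k - 2 and adds |H|^2 to tr P; for the Schouten terms, k - 2 is
    k diminished by the two mixed contractions. *)
Lemma ricci_gauss i j : ricci h i j u = weylTT g F i j u - sff0_sq g F i j u
  + (k%:R - 2) * (schoutenTT g F i j u + ipu Hu (Lu i j))
  + (trP g F u + H2) * hu i j.
Proof.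
pose P a b := schoutenTT g F a b u.
pose Wf c d := eval4 F (weyl g) (T i) (T c) (T j) (T d) u.
have -> : ricci h i j u = tr (fun c d => Wf d c + P i j * hu c d + - (hu i c *
  P d j)
   + - (P i c * hu j d) + hu i j * P d c + ipu (Lu i j) (Lu c d)
   + - ipu (Lu i c) (Lu j d)).
  rewrite (ricciE U h mh) //; apply: eq_bigr => c _; apply: eq_bigr => d _.
  (* Reversing both index pairs converts the order [d i c j] of [ricciE] into the order [i d j c] of
     [weylTT]. *)
  congr (_ * _); rewrite gauss_equation // eval4_riemannNN //
    eval4_riemann_tangent.
  rewrite (metricC U h mh u d c) // (metricC U h mh u d j) // (sffC j i) //
    (sffC c i) //.
  rewrite [ipu (Lu c d) _]ipC // [ipu (Lu j d) _]ipC // -/(Wf d c) -!/(P _ _).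
  by move: (Wf d c) (P i j) (P d j) (P i c) (P d c) (ipu _ _) (ipu _ _) => *;
    ring.
rewrite !trD !trN trZ tr_metric (tr_metricl i (fun d => P d j)).
rewrite (tr_metricr j (fun c => P i c)) trZ (trC P) (trC Wf) tr_sff sff0_sqE.
rewrite -[tr Wf]/(weylTT g F i j u) -[tr P]/(trP g F u) -/(P i j).
rewrite (ipC (G u) gT (Lu i j) Hu); move: (weylTT g F i j u) (P i j) (trP g F
  u) (tr _) => *; ring.
Qed.

Lemma scal_gauss : scal h u = trace h (weylTT g F) u - trace h (sff0_sq g F) u
  + 2 * (k%:R - 1) * trP g F u + k%:R * (k%:R - 1) * H2.
Proof.
have -> : scal h u = tr (fun i j => weylTT g F i j u + - sff0_sq g F i j u
    + (k%:R - 2) * (schoutenTT g F i j u + ipu Hu (Lu i j))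
    + (trP g F u + H2) * hu i j).
  by apply: eq_tr => i j; rewrite ricci_gauss.
rewrite !trD trN !trZ trD tr_metric tr_sff.
rewrite -[tr (fun i j => weylTT g F i j u)]/(trace h (weylTT g F) u).
rewrite -[tr (fun i j => sff0_sq g F i j u)]/(trace h (sff0_sq g F) u).
rewrite -[tr (fun i j => schoutenTT g F i j u)]/(trP g F u).
by move: (trace h _ u) (trace h _ u) (trP g F u) (ipu _ _) => *; ring.
Qed.

Lemma trB f f' : tr (fun i j => f i j - f' i j) = tr f - tr f'.
Proof. by rewrite trD trN. Qed.

Lemma trace_gauss : (1 < k)%N ->
  trP g F u + k%:R / 2 * H2 = schoutenJ h u + extG g F u.
Proof.
move=> k1; rewrite /schoutenJ /extG scal_gauss.
have k10 : k%:R - 1 != 0 :> R by rewrite subr_eq0 (eqr_nat _ k 1) gtn_eqF.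
move: (trace h _ u) (trace h _ u) (trP g F u) (ipu _ _) => a b c d; field.
by rewrite k10.
Qed.

(** Once [extG] is eliminated by the double trace, the remaining multiple of [h] is (1 - k/2)|H|^2;
    division by k - 2 makes it - |H|^2 / 2. *)
Lemma fialkow_gauss i j : (2 < k)%N ->
  schoutenTT g F i j u + ipu Hu (Lu i j) - 2^-1 * H2 * hu i j =
  schouten h i j u + fialkow g F i j u.
Proof.
move=> k2; have k1 : (1 < k)%N by exact: ltnW.
have := trace_gauss k1; rewrite /schouten /fialkow ricci_gauss -/(schoutenJ h
  u) => E.
have k20 : k%:R - 2 != 0 :> R by rewrite subr_eq0 (eqr_nat _ k 2) gtn_eqF.
move: E; move: (schoutenJ h u) (extG g F u) => J Ge E.
have -> : Ge = trP g F u + k%:R / 2 * H2 - J by rewrite E addrC addKr.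
move: (trP g F u) (weylTT g F i j u) (sff0_sq g F i j u) (schoutenTT g F i j u).
move: (h u i j) => hij *; field.
by rewrite k20.
Qed.

(** The normal projection is orthogonal, hence self-adjoint. It can thus be moved onto the
    coordinate vector, where it becomes the normal index [normal_coord j]. *)
Lemma normal_part_adjoint X Y :
  ipu (vec (normal_part g F X) u) (vec Y u) = ipu (vec X u) (vec (normal_part g
    F Y) u).
Proof.
rewrite !vec_normal_part ipDl ipDr // ipNl ipNr // ip_suml ip_sumr //.
congr (_ - _).
under eq_bigr do rewrite ipZl big_distrl /=.
under [RHS]eq_bigr do rewrite ipZr // big_distrl /=.
rewrite exchange_big; apply: eq_bigr => al _; apply: eq_bigr => be _ /=.
rewrite (ginvC U h mh u be al) // (ipC (G u) gT (vec Y u)).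
by move: (ginv h al be u) => c; ring.
Qed.

Lemma normal_part_id X : (forall be, ipu (vec X u) (t be u) = 0) ->
  vec (normal_part g F X) u = vec X u.
Proof.
move=> nX; rewrite vec_normal_part big1 ?subr0 // => al _.
by rewrite big1 ?scale0r // => be _; rewrite nX mulr0.
Qed.

Local Notation N j := (vec (normal_coord g F j) u).

Lemma lowerE X j : lower g F X j u = ipu (vec (fun i (_ : 'rV[R]_k) => (i ==
  j)%:R) u) (vec X u).
Proof.
rewrite ipE /lower [RHS](bigD1 j) //= [X in _ = _ + X]big1 ?addr0 => [|i /negPf
  ij].
  by apply: eq_bigr => i _; rewrite !mxE eqxx mulr1.
by apply: big1 => m _; rewrite !mxE ij mulr0 mul0r.
Qed.

Lemma lower_normal_part X j : lower g F (normal_part g F X) j u = ipu (N j)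
  (vec X u).
Proof. by rewrite lowerE /normal_coord -normal_part_adjoint. Qed.

Lemma lower_normal X j : (forall be, ipu (vec X u) (t be u) = 0) ->
  lower g F X j u = ipu (N j) (vec X u).
Proof.
move=> nX; rewrite lowerE -(normal_part_id X nX) -normal_part_adjoint.
by rewrite [vec (normal_part g F X) u]normal_part_id.
Qed.

Lemma ip_sff_tangent a b c : ipu (Lu a b) (t c u) = 0.
Proof. exact: ip_normal_part. Qed.

Lemma ip_meanH_tangent c : ipu Hu (t c u) = 0.
Proof.
rewrite vec_meanH ipZl ip_suml big1 ?mulr0 // => a _.
by rewrite ip_suml big1 // => b _; rewrite ipZl ip_sff_tangent mulr0.
Qed.

Lemma smooth_meanH : smooth_field (meanH g F).
Proof.
move=> i; rewrite /meanH; smooth_tac; first [exact: shi | exact: smooth_sff].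
Qed.

(* (nabla_c L)_ab paired with the normal part of the coordinate vector d_j *)
Definition nabla_sff j (c a b : 'I_k) : R :=
  ipu (N j) (vec (nabla c (L a b)) u)
  - \sum_d christoffel h d c a u * ipu (N j) (Lu d b)
  - \sum_d christoffel h d c b u * ipu (N j) (Lu a d).

Local Notation nu j c := (ipu (N j) (vec (nabla c (meanH g F)) u)).

(** The trace part of [L] is H times [h], and [h] is parallel: its derivative cancels against the
    two [christoffel1] terms. *)
Lemma lower_nabla_sff0 j c a b :
  lower g F (nabla_sff0 g F c a b) j u = nabla_sff j c a b - hu a b * nu j c.
Proof.
have sh a' b' : smooth U (fun v => h v a' b') by exact: (smooth_metric U h mh).
have lD X Y Z : lower g F (fun i v => X i v - Y i v - Z i v) j u =
    lower g F X j u - lower g F Y j u - lower g F Z j u.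
  rewrite /lower -!sumrB; apply: eq_bigr => i _; ring.
have lS (e : 'I_k -> R) (X : 'I_k -> 'I_n -> 'rV[R]_k -> R) :
    \sum_d e d * lower g F (X d) j u =
    \sum_i g (F u) j i * \sum_d e d * X d i u.
  under eq_bigr do rewrite big_distrr /=.
  rewrite exchange_big; apply: eq_bigr => i _ /=; rewrite big_distrr.
  by apply: eq_bigr => d _; rewrite mulrCA.
have ls a' b' : lower g F (sff0 g F a' b') j u =
    ipu (N j) (Lu a' b') - hu a' b' * ipu (N j) Hu.
  rewrite lower_normal; first by rewrite vec_sff0 ipDr // ipNr // ipZr.
  move=> be; rewrite vec_sff0 ipDl ipNl ipZl ip_sff_tangent ip_meanH_tangent.
  by rewrite mulr0 subr0.
have ln : lower g F (nabla_normal g F c (sff0 g F a b)) j u =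
    ipu (N j) (vec (nabla c (L a b)) u)
    - (pd c (fun v => h v a b) u * ipu (N j) Hu + hu a b * nu j c).
  rewrite lower_normal_part.
  have shN : smooth U (fun v => - h v a b) by smooth_tac.
  rewrite (eq_nabla c _ (fun i v => L a b i v + (- h v a b) * meanH g F i v))
    //.
    rewrite nablaD //; [|exact: smooth_sff|].
      rewrite (nablaZ c (fun v => - h v a b) (meanH g F) u Uu shN smooth_meanH).
      rewrite pdN; last exact: smooth_diff (sh a b) Uu.
      by rewrite !ipDr // !ipZr // !mulNr opprD.
    by move=> i; smooth_tac; exact: smooth_meanH.
  by move=> v Uv i; rewrite /sff0 mulNr mulrC.
rewrite /nabla_sff0 lD ln /nabla_sff.
have -> : lower g F (fun i v => \sum_d christoffel h d c a v * sff0 g F d b i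
  v) j u =
    \sum_d christoffel h d c a u * ipu (N j) (Lu d b)
    - christoffel1 h b c a u * ipu (N j) Hu.
  rewrite /lower -(lS (fun d => christoffel h d c a u) (fun d => sff0 g F d b)).
  rewrite -(lower_christoffel U h mh) // big_distrl -sumrB; apply: eq_bigr => d
    _ /=.
  by rewrite ls (metricC U h mh u b d) // mulrBr mulrCA mulrA.
have -> : lower g F (fun i v => \sum_d christoffel h d c b v * sff0 g F a d i
  v) j u =
    \sum_d christoffel h d c b u * ipu (N j) (Lu a d)
    - christoffel1 h a c b u * ipu (N j) Hu.
  rewrite /lower -(lS (fun d => christoffel h d c b u) (fun d => sff0 g F a d)).
  rewrite -(lower_christoffel U h mh) // big_distrl -sumrB; apply: eq_bigr => d
    _ /=.
  by rewrite ls mulrBr mulrCA mulrA.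
rewrite (pd_metric U h mh) //.
move: (christoffel1 h) => C1; set S1 := \sum_d _; set S2 := \sum_d _.
by move: S1 S2 (h u a b) => *; ring.
Qed.

(** Differentiating the factor [ginv] inside [meanH] supplies exactly the tangential connection
    terms of [nabla_sff]. *)
Lemma tr_nabla_sff j a : tr (fun c d => nabla_sff j a c d) = k%:R * nu j a.
Proof.
have sY c d : smooth_field (fun i v => ginv h c d v * L c d i v).
  by move=> i; smooth_tac; first [exact: shi | exact: smooth_sff].
have sX c : smooth_field (fun i v => \sum_d ginv h c d v * L c d i v).
  by move=> i; smooth_tac; first [exact: shi | exact: smooth_sff].
have sZ : smooth_field (fun i v => \sum_c \sum_d ginv h c d v * L c d i v).
  by move=> i; smooth_tac; first [exact: shi | exact: smooth_sff].
have -> : k%:R * nu j a = \sum_c \sum_d (pd a (ginv h c d) u * ipu (N j) (Lu c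
  d)
    + ginv h c d u * ipu (N j) (vec (nabla a (L c d)) u)).
  rewrite /meanH (nablaZ a (fun=> k%:R^-1) (fun i v => \sum_c \sum_d ginv h c d
    v * L c d i v)
    u Uu (smooth_cst _ _) sZ).
  rewrite pd_cst scale0r add0r ipZr // mulrA mulfV // mul1r.
  rewrite nabla_sum // ip_sumr //; apply: eq_bigr => c _.
  rewrite nabla_sum // ip_sumr //; apply: eq_bigr => d _.
  rewrite (nablaZ a (ginv h c d) (L c d) u Uu (shi c d) (smooth_sff c d)).
  by rewrite ipDr // !ipZr.
under [RHS]eq_bigr => c _ do under eq_bigr => d _ do rewrite (pd_ginv U h mh)
  //.
exact: trace_covariant_derivative.
Qed.

(** The connection terms mixing [c] and [a] cancel by symmetry of the Christoffel symbols; this lets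
    covariant derivatives replace the ones in [codazzi_equation]. *)
Lemma codazzi j c a b :
  eval4 F (riemann g) (normal_coord g F j) (T b) (T c) (T a) u =
  nabla_sff j c a b - nabla_sff j a c b.
Proof.
rewrite codazzi_equation //; last by move=> m; exact: ip_normal_part.
rewrite /nabla_sff.
have -> : \sum_d christoffel h d c a u * ipu (N j) (Lu d b) =
    \sum_d christoffel h d a c u * ipu (N j) (Lu d b).
  by apply: eq_bigr => d _; rewrite (christoffelC U h mh).
have alg (p q r s x : R) : p + q - (r + s) = q - x - r - (s - x - p) by ring.
exact: alg.
Qed.

(** With div L the divergence of [L], the first summand of [extD] is div L - nabla H, and the Weyl
    trace is - (div L - k nabla H) - (k - 1) P. The divergence drops out, leaving (1 - k)(P - nabla
    H). *)
Lemma extD_codazzi a j : (1 < k)%N ->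
  extD g F a j u = schoutenTN g F a j u - lower g F (nabla_normal g F a (meanH
    g F)) j u.
Proof.
move=> k1; have k10 : k%:R - 1 != 0 :> R by rewrite subr_eq0 (eqr_nat _ k 1)
  gtn_eqF.
have k1' : 1 - k%:R != 0 :> R by rewrite -opprB oppr_eq0.
pose P X Y := eval2 F (schouten g) X Y u.
have -> : lower g F (nabla_normal g F a (meanH g F)) j u = nu j a.
  exact: lower_normal_part.
have E1 : \sum_b \sum_c ginv h b c u * lower g F (nabla_sff0 g F c a b) j u =
    tr (fun b c => nabla_sff j c a b) - nu j a.
  transitivity (tr (fun b c => nabla_sff j c a b - hu a b * nu j c)).
    by apply: eq_tr => b c; rewrite lower_nabla_sff0.
  by rewrite trB (tr_metricl a (fun c => nu j c)).
have E2 : trace h (fun b c => eval4 F (weyl g) (T a) (T b) (normal_coord g F j)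
  (T c)) u
    = - (tr (fun b c => nabla_sff j c a b) - k%:R * nu j a)
      - (k%:R - 1) * schoutenTN g F a j u.
  transitivity (tr (fun b c => - (nabla_sff j b a c - nabla_sff j a b c)
     - (schoutenTN g F a j u * hu b c - P (T b) (normal_coord g F j) * hu a
       c))).
    (* Pair symmetry puts the normal vector first, as [codazzi] requires. Of the four Schouten
       terms, the two containing a product of a tangent and a normal vector vanish. *)
    apply: eq_tr => b c; rewrite eval4_weyl // eval4_riemann_pairC // codazzi.
    rewrite -!pullback_ip (ipC (G u) gT (t b u)) (ipC (G u) gT (t a u)).
    by rewrite !ip_normal_part // !mulr0 subr0 addr0.
  pose S := schoutenTN g F a j u.
  pose A b c := nabla_sff j b a c - nabla_sff j a b c.
  pose B b c := S * hu b c - P (T b) (normal_coord g F j) * hu a c.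
  rewrite [LHS](trB (fun b c => - A b c) B) (trN A).
  rewrite (trB (fun b c => nabla_sff j b a c) (fun b c => nabla_sff j a b c)).
  rewrite (trB (fun b c => S * hu b c) (fun b c => P (T b) (normal_coord g F j)
    * hu a c)).
  rewrite trZ tr_metric tr_nabla_sff.
  rewrite (trC (fun b c => nabla_sff j c a b)).
  rewrite (tr_metricr a (fun b => P (T b) (normal_coord g F j))).
  by rewrite -[P _ _]/S -/S; ring.
rewrite /extD E1 E2; move: (tr _) (schoutenTN g F a j u) => X Y; field.
by rewrite k1'.
Qed.

End Trace.

(** * Substitution into the extrinsic operators *)

Lemma smooth_schoutenTT al be : smooth U (schoutenTT g F al be).
Proof.
have sP i j := smooth_pull _ (smooth_schouten V g mg i j).
by rewrite /schoutenTT /eval2; smooth_tac; first [exact: sP | exact: sT].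
Qed.

Lemma smooth_normH2 : smooth U (normH2 g F).
Proof. exact: smooth_inner smooth_meanH smooth_meanH. Qed.

Lemma smooth_extQ2 : smooth U (extQ2 g F).
Proof.
rewrite /extQ2 /trP /trace; smooth_tac;
  first [exact: smooth_schoutenTT | exact: shi | exact: smooth_normH2].
Qed.

Lemma smooth_extT al be : smooth U (extT g F al be).
Proof.
have sh a' b' : smooth U (fun v => h v a' b') by exact: (smooth_metric U h mh).
rewrite /extT /trP /trace; smooth_tac;
  first [exact: smooth_schoutenTT | exact: shi | exact: smooth_normH2
       | exact: sh | exact: smooth_inner smooth_meanH (smooth_sff _ _)].
Qed.

Lemma smooth_paneitz_T al be : smooth U (paneitz_T h al be).
Proof.
have sh a' b' : smooth U (fun v => h v a' b') by exact: (smooth_metric U h mh).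
rewrite /paneitz_T; smooth_tac;
  first [exact: smooth_schouten | exact: smooth_schoutenJ | exact: sh].
Qed.

Lemma extQ2_gauss u : U u -> (1 < k)%N -> extQ2 g F u = schoutenJ h u + extG g
  F u.
Proof.
move=> Uu k1; rewrite -trace_gauss //; last exact: ltnW.
by rewrite /extQ2 /normH2 innerE.
Qed.

(** Smoothness comes from the identity for [extQ2], which bypasses the Weyl tensor in the formula of
    [extG]. *)
Lemma smooth_extG : (1 < k)%N -> smooth U (extG g F).
Proof.
move=> k1; have sJ := smooth_schoutenJ U h mh.
apply: (eq_smooth U (fun v => extQ2 g F v - schoutenJ h v)) => //.
  by move=> v Uv; rewrite extQ2_gauss // addrC addKr.
by smooth_tac; exact: smooth_extQ2.
Qed.

Lemma schoutenTT_fialkow u al be : U u -> (2 < k)%N ->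
  schoutenTT g F al be u + inner g F (meanH g F) (L al be) u
  - 2^-1 * normH2 g F u * h u al be = schouten h al be u + fialkow g F al be u.
Proof.
move=> Uu k2; rewrite -fialkow_gauss //; last by apply: ltnW; exact: ltnW.
by rewrite /normH2 !innerE.
Qed.

(** The coefficient (k^2 - 2k + 4)/2 is k(k - 2)/2 + 2: the first part completes tr P to [extQ2],
    the second completes P + H.L to the tensor of [schoutenTT_fialkow]. *)
Lemma extT_fialkow u al be : U u -> (2 < k)%N ->
  extT g F al be u = paneitz_T h al be u + tildeT g F al be u.
Proof.
move=> Uu k2; have := schoutenTT_fialkow u al be Uu k2.
have := extQ2_gauss u Uu (ltnW k2).
rewrite /extT /paneitz_T /tildeT /extQ2.
move: (schoutenTT g F al be u) (inner g F _ _ u) (normH2 g F u) (trP g F u).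
move: (schoutenJ h u) (extG g F u) (schouten h al be u) (fialkow g F al be u).
move: (h u al be) => hab J Ge Sh Fi P HL H2 tP E1 E2.
have -> : J = tP + k%:R / 2 * H2 - Ge by rewrite E1 addrK.
have -> : Sh = P + HL - 2^-1 * H2 * hab - Fi by rewrite E2 addrK.
by field.
Qed.

Lemma extQ4_fialkow u : U u -> (2 < k)%N ->
  extQ4 g F u = paneitz_Q h u + tildeQ4 g F u.
Proof.
move=> Uu k2; have k1 := ltnW k2.
rewrite /extQ4 /paneitz_Q /tildeQ4 /=.
rewrite (laplacianD U h mh (extQ2 g F) (schoutenJ h) (extG g F) u Uu
  (smooth_schoutenJ U h mh) (smooth_extG k1) (fun v Uv => extQ2_gauss v Uv k1)).
rewrite (inner2_sqD U h mh _ (schouten h) (fialkow g F) u Uu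
  (fun al be => schoutenTT_fialkow u al be Uu k2)).
have -> : normTN2 g F (fun al j v => schoutenTN g F al j v
    - lower g F (nabla_normal g F al (meanH g F)) j v) u = normTN2 g F (extD g
      F) u.
  rewrite /normTN2; apply: eq_bigr => al _; apply: eq_bigr => be _.
  apply: eq_bigr => i _; apply: eq_bigr => j _.
  by rewrite !extD_codazzi //; exact: ltnW.
rewrite extQ2_gauss //.
(* What remains is the expansion of two squares, whose cross terms are the mixed terms - 4 F.Pbar
   and k G Jbar of [tildeQ4]. *)
move: (weylHH g F u) (cottonH g F u) (trBach g F u) (normTN2 g F _ u).
move: (inner2 h _ _ u) (inner2 h _ _ u) (inner2 h _ _ u).
move: (laplacian h _ u) (laplacian h _ u) (schoutenJ h u) (extG g F u).
by move: (n%:R - 4)^-1 => c *; field.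
Qed.

Lemma extP4_fialkow f u : U u -> (2 < k)%N -> smooth U f ->
  extP4 g F f u = paneitz_op h f u + div_grad h (tildeT g F) f u
    + (k%:R - 4) / 2 * tildeQ4 g F u * f u.
Proof.
move=> Uu k2 sf; rewrite /extP4 /paneitz_op extQ4_fialkow //.
rewrite (div_gradD U h mh (extT g F) (paneitz_T h) (tildeT g F) f u Uu
  smooth_paneitz_T _ sf (fun v Uv al be => extT_fialkow v al be Uv k2)); last
    first.
  (* As for [extG], smoothness of [tildeT] is read off from the identity itself. *)
  move=> al be; apply: (eq_smooth U (fun v => extT g F al be v - paneitz_T h al
    be v)) => //.
    by move=> v Uv; rewrite extT_fialkow // addrC addKr.
  apply: smoothD => //; first exact: smooth_extT.
  by apply: smoothN => //; exact: smooth_paneitz_T.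
move: (laplacian h _ u) (div_grad h _ f u) (div_grad h _ f u).
by move: (paneitz_Q h u) (tildeQ4 g F u) (f u) => *; ring.
Qed.

Lemma extP2_gauss f u : U u -> (1 < k)%N ->
  extP2 g F f u = yamabe_op h f u + (k%:R - 2) / 2 * extG g F u * f u.
Proof.
move=> Uu k1; rewrite /extP2 /yamabe_op extQ2_gauss //.
by move: (laplacian h f u) (schoutenJ h u) (extG g F u) (f u) => *; ring.
Qed.

End Fields.

(** * From coordinates to the manifold *)

Lemma overlap_open {R : realType} {T : topologicalType} {n k : nat} {S : set T}
    (a : coord_patch R [set: T] n) (b : coord_patch R S k) : open (overlap a b).
Proof.
have [W oW rW] : exists2 W, open W & prange a = [set: T] `&` W by exact:
  prange_open.
have od : open (pdom b) by exact: pdom_open.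
have cb : {within pdom b, continuous b} by exact: pmap_continuous.
rewrite continuous_open_subspace // in cb.
rewrite /overlap rW setTI openE => u [du Wu]; apply: filterI.
  exact: open_nbhs_nbhs.
by apply: (cb u (mem_set du)); exact: open_nbhs_nbhs.
Qed.

Theorem theorem5p3 (R : realType) (n k : nat) (M : smooth_manifold R n)
    (g : riemannian_metric M) (S : set M)
    (hn : (3 <= n)%N) (hk : (1 <= k <= n.-1)%N) (hS : submanifold S k)
    (a : coord_patch R [set: M] n) (ha : atlas a)
    (b : coord_patch R S k) (hb : parametrization b)
    (u : 'rV[R]_k) (hu : overlap a b u) :
  let ga := g a in
  let F := in_chart a b in
  let h := pullback ga F in
  ((1 < k)%N ->
     (forall f : M -> R, smooth_on S k f ->
        extP2 ga F (f \o b) u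
        = yamabe_op h (f \o b) u + (k%:R - 2) / 2 * extG ga F u * f (b u))
     /\ extQ2 ga F u = schoutenJ h u + extG ga F u)
  /\
  ((2 < k)%N -> n <> 4%N ->
     [/\ forall f : M -> R, smooth_on S k f ->
           extP4 ga F (f \o b) u
           = paneitz_op h (f \o b) u + div_grad h (tildeT ga F) (f \o b) u
             + (k%:R - 4) / 2 * tildeQ4 ga F u * f (b u),
         forall al be : 'I_k,
           extT ga F al be u = paneitz_T h al be u + tildeT ga F al be u
       & extQ4 ga F u = paneitz_Q h u + tildeQ4 ga F u]).
Proof.
move=> ga F h.
(* On the overlap [F] is a smooth immersion into the coordinate domain of [a], which is the setting
   of the local results. *)
have UF v : overlap a b v -> pdom a (F v) by case=> _; exact: pinv_dom.
have mga : metric_on (pdom a) ga.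
  split; first exact: pdom_open.
  - exact: (@metric_smooth _ _ _ g a ha).
  - exact: (@Defs.metric_sym _ _ _ g a ha).
  - exact: (@metric_pos _ _ _ g a ha).
have oU := overlap_open a b.
have [sF rF] := hb a ha.
have sf f : smooth_on S k f -> smooth (overlap a b) (f \o b).
  by move=> /(_ b hb); apply: smooth_sub => v [].
split=> [k1|k2 _].
  split=> [f _|]; first exact: (extP2_gauss _ _ mga _ _ oU sF UF rF).
  exact: (extQ2_gauss _ _ mga _ _ oU sF UF rF).
split=> [f sfb|al be|].
- exact: (extP4_fialkow _ _ mga _ _ oU sF UF rF _ _ hu k2 (sf f sfb)).
- exact: (extT_fialkow _ _ mga _ _ oU sF UF rF).
- exact: (extQ4_fialkow _ _ mga _ _ oU sF UF rF).
Qed.
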